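(* Let $p$ be a prime, and let $n, m$ be positive integers, coprime to $p$, that are divisors of $p^{u}+1$ and $p^v+1$, respectively, where $u, v$ are nonnegative integers. Then the curve $\mathcal{F}: y^{m} = x^{n} + 1$ over $\overline{\mathbb{F}}_p$ has zero $p$-rank.
   Context: A ''curve'' given by an affine equation over $\overline{\mathbb{F}}_p$ means the nonsingular, projective, irreducible curve whose function field is defined by that equation. The $p$-rank $\gamma(\mathcal{X})$ of a curve $\mathcal{X}$ with Jacobian $J$ is the integer such that $J[p](\overline{\mathbb{F}}_p)\cong(\mathbb{Z}/p\mathbb{Z})^{\gamma(\mathcal{X})}$; a curve of genus $0$ has $p$-rank $0$. *)

(* Defs.v *)
From HB Require Import structures.
From mathcomp Require Import all_boot all_order all_algebra.
From mathcomp Require Import ring_quotient.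
From mathcomp Require Import boolp.
From mathcomp Require Import freeg.

Set Implicit Arguments.
Unset Strict Implicit.
Unset Printing Implicit Defensive.

Import Order.TTheory GRing.Theory Num.Theory.
Local Open Scope ring_scope.

(* A nonsingular projective irreducible curve over the algebraically closed
   field k is handled through its function field K (with structure map iota):
   its points are the places of K/k. *)
Section Curve.

Variables (k : closedFieldType) (K : fieldType) (iota : {rmorphism k -> K}).

(* K is the fraction field of k[X, Y] / (f), X and Y being sent to x and y.
   The first clause also forces f to generate a prime ideal. *)
Definition is_function_field (f : {poly {poly k}}) (x y : K) : Prop :=
  let ev (P : {poly {poly k}}) : K := (map_poly (map_poly iota) P).[x, y] in
  (forall P, ev P = 0 <-> exists Q, P = Q * f) /\
  (forall z, exists P Q, ev Q != 0 /\ z = ev P / ev Q).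

(* A place is given by its normalized discrete valuation, trivial on k. The
   valuation of 0 (mathematically +oo) is set to 0, so that two places are
   equal as soon as their valuations agree on nonzero functions. *)
Record place := Place {
  ord : K -> int;
  ord0 : ord 0 = 0;
  ordM : forall f g, f != 0 -> g != 0 -> ord (f * g) = ord f + ord g;
  ordD : forall f g, f != 0 -> g != 0 -> f + g != 0 ->
    Num.min (ord f) (ord g) <= ord (f + g);
  ord_const : forall c, c != 0 -> ord (iota c) = 0;
  ord_uniformizer : exists t, ord t = 1
}.

(* Residue fields all equal k, so the degree of a divisor is [deg], the plain
   sum of its coefficients. *)
Definition divisor := {freeg {classic place} / int}.
HB.instance Definition _ := GRing.Zmodule.on divisor.

Definition is_div (f : K) (D : divisor) : Prop :=
  forall P : place, coeff (P : {classic place}) D = ord P f.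

Definition deg0_pred : {pred divisor} := fun D => deg D == 0.

Fact deg0_zmod_closed : zmod_closed deg0_pred.
Proof.
split=> [|D E]; rewrite !unfold_in ?raddf0 // => /eqP D0 /eqP E0.
by rewrite raddfB /= D0 E0 subrr.
Qed.

HB.instance Definition _ :=
  GRing.isZmodClosed.Build divisor deg0_pred deg0_zmod_closed.

Record divisor0 := Divisor0 {
  divisor0_val :> divisor; _ : divisor0_val \in deg0_pred
}.
HB.instance Definition _ := [isSub for divisor0_val].
HB.instance Definition _ := [Choice of divisor0 by <:].
HB.instance Definition _ := [SubChoice_isSubZmodule of divisor0 by <:].

Definition principal : {pred divisor0} :=
  fun D => `[< exists2 f : K, f != 0 & is_div f (divisor0_val D) >].

Fact principal_zmod_closed : zmod_closed principal.
Proof.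
have ord1 (P : place) : ord P 1 = 0.
  by rewrite -(rmorph1 iota) ord_const // oner_neq0.
have ordV (P : place) g : g != 0 -> ord P g^-1 = - ord P g.
  move=> g0; apply/eqP; rewrite -addr_eq0 -ordM ?invr_eq0 //.
  by rewrite mulVf // ord1.
split=> [|D E]; rewrite !unfold_in.
  apply/asboolP; exists 1; first exact: oner_neq0.
  by move=> P; rewrite ord1; exact: coeff0.
move=> /asboolP[f f0 fD] /asboolP[g g0 gE]; apply/asboolP; exists (f / g).
  by rewrite mulf_neq0 ?invr_eq0.
move=> P.
have -> : divisor0_val (D - E) = divisor0_val D - divisor0_val E by [].
by rewrite coeffB fD gE ordM ?invr_eq0 // ordV.
Qed.

HB.instance Definition _ :=
  GRing.isZmodClosed.Build divisor0 principal principal_zmod_closed.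

(* The group J(k) = Pic^0 of k-points of the Jacobian. *)
Definition jacobian : zmodType := Quotient.quot principal.

(* J[p](k) is isomorphic to (Z/pZ)^g. *)
Definition has_p_rank (p g : nat) : Prop :=
  exists phi : {additive 'rV['F_p]_g -> jacobian},
    injective phi /\ (forall c : jacobian, c *+ p = 0 <-> exists w, c = phi w).

End Curve.

(* Following the convention of [polyXY], 'X is the outer variable and 'Y the
   inner one, and P.[x, y] evaluates 'X at x and 'Y at y. *)
Definition fermat_curve (k : closedFieldType) (n m : nat) : {poly {poly k}} :=
  'Y ^+ m - ('X ^+ n + 1).

(* Main.v *)
From HB Require Import structures.
From mathcomp Require Import all_boot all_order all_algebra.
From mathcomp Require Import cyclic separable cyclotomic.
From mathcomp Require Import generic_quotient ring_quotient boolp freeg.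
From mathcomp Require Import zify ring.
Require Import Defs.

Set Implicit Arguments.
Unset Strict Implicit.
Unset Printing Implicit Defensive.

Import Order.TTheory GRing.Theory Num.Theory.
Local Open Scope ring_scope.

(** The [p]-torsion of the Jacobian is controlled by logarithmic differentials.
    If [D] has degree [0] and [p D = div f], then every order of [f] is divisible
    by [p], so the differential [df / f] has no pole.  On the curves considered
    here such a differential must vanish.  Then [f] has zero derivative, hence is
    a [p]-th power [b ^+ p] as [k] is perfect, and [D = div b] is principal: the
    Jacobian has no [p]-torsion.

    Why [df / f] vanishes.  Put [h = x f' / f], so that [df / f = h dx / x].  The
    regular differentials are spanned by the [x ^ i y ^ -j dx / x] with [i > 0],
    [j < m] and [i / n < j / m].  Let [q > 1] be a power of [p] congruent to [1]
    modulo [n] and [m], and let [L = i (q - 1) / n] and [M = j (q - 1) / m].  Then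
    [y ^ -j = y ^ (- j q) (1 + x ^ n) ^ M], and in [x ^ i y ^ -j] the exponents
    divisible by [q] (for the expansion in [x] at a point with [x = 0]) come only
    from the monomial [x ^ (i q)] of [x ^ i (1 + x ^ n) ^ M], whose coefficient is
    the binomial ['C(M, L)].  In base [p], because [n] divides [p ^ u + 1], the
    digits of [L] average [(p - 1) / 2]; the same holds for [M].  So [L < M] have
    the same digit sum, there must be a carry in [L + (M - L)], and [p] divides
    ['C(M, L)] ([dvdn_bin_residue]).  In other words an iterate of the Cartier
    operator kills all regular differentials ([coef_monomial_vanish]).  But it
    fixes the logarithmic ones up to Frobenius: the coefficients of [h] satisfy
    [h_(q N) = h_N ^ q] ([log_series_frob]).  Hence [h = 0].

    That [h] is a combination of the monomials above is obtained from valuations.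
    Writing [f] as a combination of powers of [x] with [p]-th powers as
    coefficients ([pth_span_all]) gives [h] as an element of [K].  Any solution of
    the equation of the curve in the Laurent series, with nonconstant abscissa,
    embeds [K] there ([ext_rmorphism]) and thereby defines a place
    ([place_of_embedding]).  The orders of [f] being divisible by [p], the
    logarithmic derivative of its image has no pole ([dlog_regular]).  Multiplying both coordinates by roots of unity
    isolates the components of [h] along the [x ^ i y ^ -j] over [k(x ^ n)]
    ([component_vge]), and letting [x ^ n] be [c + t ^ (n m)] for all [c], then
    [t ^ - (n m)], shows that these components are constant and satisfy the
    inequality ([component_dvdp], [component_const]). *)

(** * Divisibility of binomial coefficients *)

Section BinomialResidues.
Local Open Scope nat_scope.

Lemma sum_shift_period (a : nat -> nat) N w :
  (forall k, a (k + N) = a k) ->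
  \sum_(k < N) a (k + w) = \sum_(k < N) a k.
Proof.
move=> per; elim: w => [|w IH]; first by apply: eq_bigr => k _; rewrite addn0.
rewrite -IH; case: N per {IH} => [|N] per; first by rewrite !big_ord0.
rewrite big_ord_recr [RHS]big_ord_recl /= addnC; congr (_ + _).
  by rewrite add0n -(per w) addnC addSnnS.
by apply: eq_bigr => k _; rewrite /bump /= add1n addSnnS.
Qed.

(** As [p ^ v] is [-1] modulo [m], the residues at [k] and [k + v] add up to [m]:
    over a period they average [m / 2]. *)
Lemma sum_residues p m v N j :
  m %| p ^ v + 1 -> p ^ N = 1 %[mod m] -> 0 < j < m -> coprime p m ->
  2 * \sum_(k < N) (j * p ^ k) %% m = m * N.
Proof.
move=> dv pN /andP[j0 jm] cop; set S := bigop _ _ _.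
pose a k := (j * p ^ k) %% m.
have per k : a (k + N) = a k.
  by rewrite /a expnD mulnA -modnMmr pN modnMmr muln1.
have a0 k : 0 < a k.
  rewrite lt0n; apply/negP => /eqP H0.
  have : m %| j * p ^ k by rewrite /dvdn -/(a k) H0.
  rewrite Gauss_dvdl; last by rewrite coprime_sym coprimeXl.
  by move=> /(dvdn_leq j0); rewrite leqNgt jm.
have flip k : a (k + v) + a k = m.
  have d : m %| a (k + v) + a k.
    rewrite /dvdn modnDm expnD mulnA -{2}[j * p ^ k]muln1 -mulnDr.
    by rewrite -modnMmr (eqP dv) muln0 mod0n.
  have m0 : 0 < m by lia.
  have := a0 k; have := ltn_pmod (j * p ^ k) m0.
  have := ltn_pmod (j * p ^ (k + v)) m0.
  rewrite -/(a k) -/(a (k + v)); case/dvdnP: d => c Hc.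
  by rewrite Hc; case: c Hc => [|[|c]]; nia.
have := sum_shift_period v per; rewrite -/S => HS.
have : \sum_(k < N) (a (k + v) + a k) = m * N.
  by rewrite (eq_bigr (fun=> m)) // sum_nat_const card_ord mulnC.
by rewrite big_split /= HS mul2n -addnn.
Qed.

(** The difference [j / (m p ^ k)] between [j p ^ (N - k) / m] and [M / p ^ k] is too
    small to change the floor, so the terms of Legendre's formula for [M`!] are
    explicit. *)
Lemma div_pow_residue p m N j M k : 0 < p ->
  p ^ N = 1 %[mod m] -> 0 < j < m -> m * M = j * (p ^ N).-1 -> k <= N ->
  m * (M %/ p ^ k) + (j * p ^ (N - k)) %% m = j * p ^ (N - k).
Proof.
move=> p0 pN /andP[j0 jm] HM kN.
set r := _ %% m; set Q := (j * p ^ (N - k)) %/ m.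
have E : j * p ^ (N - k) = Q * m + r by exact: divn_eq.
have m0 : 0 < m by lia.
have rm : r < m by rewrite ltn_pmod.
have pk : 0 < p ^ k by rewrite expn_gt0 p0.
have Eq : p ^ N = p ^ k * p ^ (N - k) by rewrite -expnD subnKC.
have H1 : (p ^ k * r) %% m = j.
  rewrite /r modnMmr mulnCA -Eq -modnMmr pN modnMmr muln1.
  by rewrite modn_small.
have jr : j <= p ^ k * r by rewrite -{1}H1 leq_mod.
have [s Hs] : exists s, p ^ k * r = j + m * s.
  by exists ((p ^ k * r) %/ m); rewrite {1}(divn_eq (p ^ k * r) m) H1 addnC mulnC.
have q0 : 0 < p ^ N by rewrite expn_gt0 p0.
have EM : M = Q * p ^ k + s.
  apply/eqP; rewrite -(eqn_pmul2l m0) HM; apply/eqP.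
  have -> : j * (p ^ N).-1 = j * p ^ N - j by rewrite -subn1 mulnBr muln1.
  rewrite Eq mulnCA E mulnDr Hs addnCA addKn mulnDr; congr (_ + _).
  by rewrite [RHS]mulnCA mulnA mulnC mulnA mulnC mulnA [Q * m]mulnC.
suff -> : M %/ p ^ k = Q by rewrite E mulnC.
rewrite EM divnMDl // divn_small ?addn0 //.
rewrite -(ltn_pmul2l m0); apply: leq_ltn_trans (_ : p ^ k * r < _).
  by rewrite Hs leq_addl.
by rewrite mulnC ltn_pmul2r.
Qed.

Lemma logn_fact_bound p N M : prime p -> M < p ^ N ->
  logn p M`! = \sum_(k < N) M %/ p ^ k.+1.
Proof.
move=> pp MN; rewrite logn_fact // big_add1 /= big_mkord.
have p1 := prime_gt1 pp.
pose B := maxn M N.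
have ext C : (forall k, C <= k -> M < p ^ k.+1) -> C <= B ->
    \sum_(k < C) M %/ p ^ k.+1 = \sum_(k < B) M %/ p ^ k.+1.
  move=> HC CB; rewrite -(subnKC CB) big_split_ord /= [X in _ = _ + X]big1 ?addn0 //.
  by move=> k _; rewrite divn_small // HC // leq_addr.
rewrite !ext ?leq_maxl ?leq_maxr // => k Hk.
  by apply: leq_trans MN _; rewrite leq_exp2l // ltnW.
by apply: ltn_trans (ltn_expl _ p1) _; rewrite ltn_exp2l.
Qed.

Lemma sum_divn_pow p N d : 1 < p -> 0 < d ->
  p.-1 * \sum_(k < N) d %/ p ^ k.+1 < d.
Proof.
move=> p1 d0; have q0 : 0 < p ^ N by rewrite expn_gt0; lia.
rewrite -(ltn_pmul2l q0).
have : p ^ N * \sum_(k < N) d %/ p ^ k.+1 <= d * \sum_(k < N) p ^ k.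
  rewrite !big_distrr /= [X in _ <= X](reindex_inj rev_ord_inj) /=.
  apply: leq_sum => k _.
  rewrite -{1}(subnK (ltn_ord k)) expnD -mulnA [X in _ <= X]mulnC leq_mul2l.
  by apply/orP; right; rewrite mulnC leq_divM.
have := predn_exp p N; have : 0 < p.-1 by lia.
nia.
Qed.

(** Kummer's theorem in disguise: [L] and [M] have base [p] digits averaging
    [(p - 1) / 2], hence equal digit sums, which forces a carry in the addition of
    [L] and [M - L]. *)
Lemma dvdn_bin_residue p N n m u v i j L M : prime p ->
  n %| p ^ u + 1 -> m %| p ^ v + 1 ->
  coprime p n -> coprime p m ->
  p ^ N = 1 %[mod n] -> p ^ N = 1 %[mod m] ->
  0 < i < n -> 0 < j < m -> i * m < j * n ->
  n * L = i * (p ^ N).-1 -> m * M = j * (p ^ N).-1 -> 0 < N ->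
  p %| 'C(M, L).
Proof.
move=> pp nu mv cn cm pn pm hi hj ij HL HM N0.
have p1 := prime_gt1 pp; have p0 : 0 < p by lia.
have q1 : 1 < p ^ N by rewrite -(expn0 p) ltn_exp2l.
have n0 : 0 < n by case/andP: hi => _; apply: leq_ltn_trans.
have m0 : 0 < m by case/andP: hj => _; apply: leq_ltn_trans.
have nm0 : 0 < n * m by rewrite muln_gt0 n0.
have q'0 : 0 < (p ^ N).-1 by rewrite -subn1 subn_gt0.
have LM : L < M.
  rewrite -(ltn_pmul2l nm0) [n * m * L]mulnAC HL -[n * m * M]mulnA HM mulnAC [n * _]mulnA [n * j]mulnC.
  by rewrite ltn_pmul2r.
have Mq : M < p ^ N.
  case/andP: hj => j0 jm; rewrite -(ltn_pmul2l m0) HM; apply: leq_ltn_trans (_ : m * (p ^ N).-1 < _).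
    by rewrite leq_mul2r ltnW ?orbT.
  by rewrite ltn_pmul2l // prednK // expn_gt0 p0.
pose T a := \sum_(k < N) a %/ p ^ k.+1.
pose G := \sum_(k < N) p ^ k.
have key n' v' i' L' : n' %| p ^ v' + 1 -> coprime p n' -> p ^ N = 1 %[mod n'] ->
    0 < i' < n' -> n' * L' = i' * (p ^ N).-1 ->
    2 * (n' * T L') + n' * N = 2 * (i' * G).
  move=> H1 H2 H3 H4 H5; rewrite -(sum_residues H1 H3 H4 H2) -mulnDr; congr (_ * _).
  rewrite [X in _ + X](reindex_inj rev_ord_inj) /= /T /G [in RHS](reindex_inj rev_ord_inj) /=.
  rewrite !big_distrr -big_split /=; apply: eq_bigr => k _.
  exact: div_pow_residue.
have KL := key _ _ _ _ nu cn pn hi HL; have KM := key _ _ _ _ mv cm pm hj HM.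
have GE : p.-1 * G = (p ^ N).-1 by rewrite -predn_exp.
(* By Legendre's formula this equates the digit sums of [L] and [M]. *)
have E : M - L + p.-1 * T L = p.-1 * T M.
  apply/eqP; rewrite -(eqn_pmul2l nm0) mulnDr mulnBr; apply/eqP.
  have -> : n * m * M = n * j * (p.-1 * G) by rewrite -mulnA HM GE mulnA.
  have -> : n * m * L = m * i * (p.-1 * G) by rewrite mulnAC HL GE mulnC mulnA.
  have H : n * j * G + n * (m * T L) = m * i * G + n * (m * T M).
    have H1 : 2 * (n * (m * T L)) + n * m * N = 2 * (m * i * G).
      have -> : 2 * (m * i * G) = m * (2 * (i * G)) by ring.
      by rewrite -KL; ring.
    have H2 : 2 * (n * (m * T M)) + n * m * N = 2 * (n * j * G).
      have -> : 2 * (n * j * G) = n * (2 * (j * G)) by ring.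
      by rewrite -KM; ring.
    by move: H1 H2; clear; lia.
  have H' : n * m * (p.-1 * T L) + n * j * (p.-1 * G) =
      n * m * (p.-1 * T M) + m * i * (p.-1 * G).
    have -> : n * m * (p.-1 * T L) + n * j * (p.-1 * G) =
        p.-1 * (n * j * G + n * (m * T L)) by ring.
    by rewrite H; ring.
  have H2 : m * i * (p.-1 * G) <= n * j * (p.-1 * G).
    by rewrite leq_mul2r [m * i]mulnC [n * j]mulnC ltnW ?orbT.
  by move: H' H2; clear; lia.
have Hd : p.-1 * T (M - L) < M - L by apply: sum_divn_pow; rewrite ?subn_gt0.
have B0 : 0 < 'C(M, L) by rewrite bin_gt0 ltnW.
have := congr1 (logn p) (bin_fact (ltnW LM)).
rewrite !lognM ?muln_gt0 ?fact_gt0 //.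
rewrite !(@logn_fact_bound _ N) //; try by apply: leq_ltn_trans Mq; rewrite ?leq_subr // ltnW.
rewrite -!/(T _) => Hl.
rewrite -[p]expn1 pfactor_dvdn // lt0n; apply/eqP => b0.
by move: E Hd; rewrite -Hl b0 mulnDr; clear; lia.
Qed.

End BinomialResidues.

(** * Formal power series *)

Definition series (R : Type) := nat -> R.
(* Opaque, so that simplification leaves boolean equalities alone. *)
Fact series_hasDecEq (R : Type) : hasDecEq (series R).
Proof. exact: gen_eqMixin. Qed.
HB.instance Definition _ (R : Type) := series_hasDecEq R.
HB.instance Definition _ (R : Type) := gen_choiceMixin (series R).

Section SeriesRing.
Variable R : comNzRingType.
Implicit Types (F G H : series R) (P Q : {poly R}).

Definition series_of_poly P : series R := fun i => P`_i.
Definition add_series F G : series R := fun i => F i + G i.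
Definition opp_series F : series R := fun i => - F i.
Definition mul_series F G : series R := fun N => \sum_(i < N.+1) F i * G (N - i)%N.

Fact add_seriesA : associative add_series.
Proof. by move=> F G H; apply: funext => i; exact: addrA. Qed.
Fact add_seriesC : commutative add_series.
Proof. by move=> F G; apply: funext => i; exact: addrC. Qed.
Fact add_series0 : left_id (series_of_poly 0) add_series.
Proof.
by move=> F; apply: funext => i; rewrite /add_series /series_of_poly coef0 add0r.
Qed.
Fact add_seriesN : left_inverse (series_of_poly 0) opp_series add_series.
Proof.
by move=> F; apply: funext => i; rewrite /add_series /series_of_poly coef0 addNr.
Qed.

HB.instance Definition _ :=
  GRing.isZmodule.Build (series R) add_seriesA add_seriesC add_series0 add_seriesN.

(** A coefficient of a product only depends on truncations of the factors, so the
    ring axioms are inherited from polynomials. *)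
Lemma coef_mul_series F G P Q N :
  (forall i, (i <= N)%N -> P`_i = F i) -> (forall i, (i <= N)%N -> Q`_i = G i) ->
  (P * Q)`_N = mul_series F G N.
Proof.
move=> PF QG; rewrite coefM; apply: eq_bigr => i _.
by rewrite PF ?QG ?leq_subr // -ltnS.
Qed.

Definition truncate N F : {poly R} := \poly_(i < N.+1) F i.
Lemma coef_truncate N F i : (i <= N)%N -> (truncate N F)`_i = F i.
Proof. by move=> iN; rewrite coef_poly ltnS iN. Qed.

Fact mul_seriesA : associative mul_series.
Proof.
move=> F G H; apply: funext => N.
have tE := coef_truncate.
transitivity ((truncate N F * (truncate N G * truncate N H))`_N).
  symmetry; apply: coef_mul_series => i iN; first exact: tE.
  by apply: coef_mul_series => j ji; rewrite tE // (leq_trans ji).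
rewrite mulrA; apply: coef_mul_series => i iN; last exact: tE.
by apply: coef_mul_series => j ji; rewrite tE // (leq_trans ji).
Qed.
Fact mul_seriesC : commutative mul_series.
Proof.
move=> F G; apply: funext => N.
rewrite -(coef_mul_series (@coef_truncate N F) (@coef_truncate N G)).
by rewrite mulrC; apply: coef_mul_series; exact: coef_truncate.
Qed.
Fact mul_series1 : left_id (series_of_poly 1) mul_series.
Proof.
move=> F; apply: funext => N.
rewrite -(@coef_mul_series _ _ 1 (truncate N F) N) //.
  by rewrite mul1r coef_truncate.
exact: coef_truncate.
Qed.
Fact mul_seriesDl : left_distributive mul_series +%R.
Proof.
move=> F G H; apply: funext => N.
rewrite -[RHS]/(mul_series F H N + mul_series G H N) /mul_series -big_split /=.
by apply: eq_bigr => i _; rewrite -mulrDl.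
Qed.
Fact series1_neq0 : series_of_poly 1 != 0.
Proof.
apply/eqP => /(congr1 (fun F : series R => F 0%N)) H.
have {H} : (1 : {poly R})`_0 = (0 : {poly R})`_0 by exact: H.
by rewrite coef1 coef0 => /eqP; rewrite oner_eq0.
Qed.

HB.instance Definition _ := GRing.Zmodule_isComNzRing.Build (series R)
  mul_seriesA mul_seriesC mul_series1 mul_seriesDl series1_neq0.

Lemma coefs0 i : (0 : series R) i = 0. Proof. exact: coef0. Qed.
Lemma coefsD F G i : (F + G) i = F i + G i. Proof. by []. Qed.
Lemma coefsB F G i : (F - G) i = F i - G i. Proof. by []. Qed.
Lemma coefsM F G N : (F * G) N = \sum_(i < N.+1) F i * G (N - i)%N.
Proof. by []. Qed.
Lemma coefs_poly P i : series_of_poly P i = P`_i. Proof. by []. Qed.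
Lemma coefs_sum I (r : seq I) (p : pred I) (f : I -> series R) N :
  (\sum_(i <- r | p i) f i) N = \sum_(i <- r | p i) f i N.
Proof. by elim/big_rec2: _ => [|i a F _ <-]; rewrite ?coefs0. Qed.

Fact series_of_poly_zmod : zmod_morphism series_of_poly.
Proof. by move=> P Q; apply: funext => i; rewrite coefsB !coefs_poly coefB. Qed.
Fact series_of_poly_monoid : monoid_morphism series_of_poly.
Proof.
split=> // P Q; apply: funext => N; rewrite coefs_poly.
exact: coef_mul_series.
Qed.
HB.instance Definition _ := GRing.isZmodMorphism.Build _ _ series_of_poly
  series_of_poly_zmod.
HB.instance Definition _ := GRing.isMonoidMorphism.Build _ _ series_of_poly
  series_of_poly_monoid.

Local Notation t := (series_of_poly 'X).
Local Notation C c := (series_of_poly c%:P).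

Lemma coefsCM c F i : (C c * F) i = c * F i.
Proof.
rewrite coefsM big_ord_recl /= subn0 coefs_poly coefC eqxx big1 ?addr0 //.
by move=> j _; rewrite coefs_poly coefC /= mul0r.
Qed.

Lemma coefsXnM a F i : (t ^+ a * F) i = if (i < a)%N then 0 else F (i - a)%N.
Proof.
rewrite -rmorphXn /=.
rewrite -[LHS](@coef_mul_series _ _ 'X^a (truncate i F)) //; last first.
  by move=> j ji; rewrite coef_truncate.
by rewrite coefXnM; case: ifP => // ai; rewrite coef_truncate // leq_subr.
Qed.

Lemma coefsXM F i : (t * F) i = if i is j.+1 then F j else 0.
Proof. by rewrite -[t]expr1 coefsXnM; case: i => //= i; rewrite subn1. Qed.

(** Congruence modulo [t ^ N]. *)
Definition agree N F G := forall i, (i < N)%N -> F i = G i.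

Lemma agreeM N F G F' G' : agree N F G -> agree N F' G' -> agree N (F * F') (G * G').
Proof.
move=> FG FG' i iN; rewrite !coefsM; apply: eq_bigr => j _.
by rewrite FG ?FG' // (leq_ltn_trans _ iN) ?leq_subr // -ltnS.
Qed.

Lemma agreeX N F G e : agree N F G -> agree N (F ^+ e) (G ^+ e).
Proof. by move=> FG; elim: e => // e IH; rewrite !exprS; exact: agreeM. Qed.

Lemma agree_truncate N F : agree N.+1 F (series_of_poly (truncate N F)).
Proof. by move=> i iN; rewrite coefs_poly coef_truncate. Qed.

Definition deriv_series F : series R := fun i => F i.+1 *+ i.+1.

Lemma deriv_seriesD F G : deriv_series (F + G) = deriv_series F + deriv_series G.
Proof. by apply: funext => i; rewrite coefsD /deriv_series -mulrnDl. Qed.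

Lemma deriv_series_poly P : deriv_series (series_of_poly P) = series_of_poly P^`().
Proof. by apply: funext => i; rewrite coefs_poly coef_deriv. Qed.

Lemma agree_deriv N F G : agree N.+1 F G -> agree N (deriv_series F) (deriv_series G).
Proof. by move=> FG i iN; rewrite /deriv_series FG. Qed.

Lemma deriv_seriesM F G :
  deriv_series (F * G) = deriv_series F * G + F * deriv_series G.
Proof.
apply: funext => N.
have tF := @agree_truncate N.+1 F.
have tG := @agree_truncate N.+1 G.
rewrite (agree_deriv (agreeM tF tG)) // -rmorphM deriv_series_poly derivM.
rewrite rmorphD !rmorphM /= !coefsD -!deriv_series_poly.
have lift A B : agree N.+2 A B -> agree N.+1 A B.
  by move=> AB i iN; apply: AB; rewrite ltnW.
congr (_ + _); apply/esym/(@agreeM N.+1) => //.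
- exact: agree_deriv tF.
- exact: lift tG.
- exact: lift tF.
- exact: agree_deriv tG.
Qed.

Lemma agreeD N F G F' G' : agree N F G -> agree N F' G' -> agree N (F + F') (G + G').
Proof. by move=> FG FG' i iN; rewrite !coefsD FG ?FG'. Qed.

Lemma agree_horner N F G (p : {poly series R}) : agree N F G -> agree N p.[F] p.[G].
Proof.
move=> FG; elim/poly_ind: p => [|p c IH]; first by rewrite !horner0.
by rewrite !hornerMXaddC; apply: agreeD => //; exact: agreeM.
Qed.

Lemma coefsMn F e i : (F *+ e) i = F i *+ e.
Proof. by elim: e => [|e IH]; rewrite ?mulr0n ?coefs0 // !mulrSr coefsD IH. Qed.

Lemma coefs1_0 : (1 : series R) 0%N = 1.
Proof. by rewrite -(rmorph1 series_of_poly) /= coefs_poly coef1. Qed.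

Lemma coefsXn a i : (t ^+ a : series R) i = (i == a)%:R.
Proof. by rewrite -rmorphXn /= coefs_poly coefXn. Qed.

Lemma deriv_series1 : deriv_series 1 = 0.
Proof.
by rewrite -(rmorph1 series_of_poly) /= deriv_series_poly derivC rmorph0.
Qed.

Lemma horner_taylor2 (A : comNzRingType) (p : {poly A}) (a d : A) :
  exists s, p.[a + d] = p.[a] + p^`().[a] * d + d ^+ 2 * s.
Proof.
elim/poly_ind: p => [|p c [s IH]].
  by exists 0; rewrite deriv0 !horner0; ring.
exists (s * (a + d) + p^`().[a]).
by rewrite derivMXaddC hornerD hornerMX !hornerMXaddC IH; ring.
Qed.

End SeriesRing.

Section SeriesField.
Variable k : fieldType.
Implicit Types (F G H : series k).
Local Notation t := (series_of_poly 'X).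
Local Notation C c := (series_of_poly c%:P).

Definition ord_series F : nat :=
  if pselect (exists i, F i != 0) is left e then ex_minn e else 0%N.

Lemma ord_seriesP F : F != 0 ->
  exists2 U : series k, U 0%N != 0 & F = t ^+ ord_series F * U.
Proof.
move=> F0; rewrite /ord_series; case: pselect => [e|H]; last first.
  case/eqP: F0; apply: funext => i; rewrite coefs0; apply/eqP.
  by case: (eqVneq (F i) 0) => // ?; case: H; exists i.
case: ex_minnP => a Fa amin; exists (fun i => F (i + a)%N); first by rewrite add0n.
apply: funext => i; rewrite coefsXnM; case: ltnP => [ia|ai]; last by rewrite subnK.
by apply/eqP; apply: contraLR ia => Fi; rewrite -leqNgt amin.
Qed.

Lemma ord_series_unique a F U : F = t ^+ a * U -> U 0%N != 0 -> ord_series F = a.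
Proof.
move=> FE U0; rewrite /ord_series; case: pselect => [e|[]]; last first.
  by exists a; rewrite FE coefsXnM ltnn subnn.
case: ex_minnP => b Fb bmin; apply/eqP; rewrite eqn_leq bmin.
  by move: Fb; rewrite FE coefsXnM; case: ltnP; rewrite ?eqxx.
by rewrite FE coefsXnM ltnn subnn.
Qed.

Lemma coefsM0 F G : (F * G) 0%N = F 0%N * G 0%N.
Proof. by rewrite coefsM big_ord1. Qed.

Definition unit_series : pred (series k) := fun F => `[< exists G, G * F = 1 >].
(** Invertibility is decided, and the inverse chosen, classically: only the
    integral domain structure matters for building the field of fractions. *)
Definition inv_series F : series k :=
  if pselect (exists G, G * F = 1) is left e then sval (cid e) else F.

Fact mul_inv_series : {in unit_series, left_inverse 1 inv_series *%R}.
Proof.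
move=> F /asboolP uF; rewrite /inv_series; case: pselect => // e.
exact: (svalP (cid e)).
Qed.
Fact unit_seriesP F G : G * F = 1 -> unit_series F.
Proof. by move=> GF; apply/asboolP; exists G. Qed.
Fact inv_series_out : {in [predC unit_series], inv_series =1 id}.
Proof.
move=> F; rewrite inE /= => /asboolP uF; rewrite /inv_series.
by case: pselect.
Qed.
HB.instance Definition _ := GRing.ComNzRing_hasMulInverse.Build (series k)
  mul_inv_series unit_seriesP inv_series_out.

Fact series_integral F G : F * G = 0 -> (F == 0) || (G == 0).
Proof.
case: (eqVneq F 0) => //= F0; case: (eqVneq G 0) => //= G0.
have [U U0 ->] := ord_seriesP F0; have [V V0 ->] := ord_seriesP G0.
rewrite mulrACA -exprD; set a := (_ + _)%N.
move/(congr1 (fun F : series k => F a)).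
rewrite coefsXnM ltnn subnn coefs0 coefsM0 => /eqP.
by rewrite mulf_eq0 (negbTE U0) (negbTE V0).
Qed.
HB.instance Definition _ := GRing.ComUnitRing_isIntegral.Build (series k)
  series_integral.

Lemma ord_seriesM F G : F != 0 -> G != 0 ->
  ord_series (F * G) = (ord_series F + ord_series G)%N.
Proof.
move=> /ord_seriesP[U U0 {1}->] /ord_seriesP[V V0 {1}->].
apply: (@ord_series_unique _ _ (U * V)); last by rewrite coefsM0 mulf_neq0.
by rewrite mulrACA -exprD.
Qed.

Lemma ord_seriesXn a : ord_series (t ^+ a) = a.
Proof.
apply: (@ord_series_unique _ _ 1); first by rewrite mulr1.
by rewrite -(rmorph1 (@series_of_poly k)) /= coefs_poly coefC oner_eq0.
Qed.

Lemma ord_series_leP N F : F != 0 -> (N <= ord_series F)%N <-> agree N F 0.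
Proof.
move=> F0; have [U U0 FE] := ord_seriesP F0; split=> [le i iN|F0N].
  by rewrite FE coefsXnM (leq_trans iN le) coefs0.
rewrite leqNgt; apply/negP => lt; move: (F0N _ lt).
by rewrite {1}FE coefsXnM ltnn subnn coefs0; apply/eqP.
Qed.

Section Hensel.
Variables (f : {poly series k}) (y0 : k).
Hypothesis f0 : f.[C y0] 0%N = 0.
Hypothesis f'0 : f^`().[C y0] 0%N != 0.

Fixpoint hensel_approx N : series k :=
  if N is N'.+1 then
    let y := hensel_approx N' in y + t ^+ N * C (- (f.[y] N / f^`().[C y0] 0%N))
  else C y0.

Lemma hensel_approx_mod N M :
  (N <= M)%N -> agree N.+1 (hensel_approx M) (hensel_approx N).
Proof.
elim: M => [|M IH]; first by case: N.
rewrite leq_eqVlt => /predU1P[-> //|NM] i iN.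
by rewrite /= coefsD coefsXnM (leq_trans iN) // addr0 IH.
Qed.

Lemma hensel_approx_root N : agree N.+1 f.[hensel_approx N] 0.
Proof.
elim: N => [|N IH] i; first by rewrite ltnS leqn0 => /eqP ->; rewrite f0 coefs0.
rewrite ltnS => iN; rewrite /=.
set y := hensel_approx N; set c := - _.
have [s ->] := horner_taylor2 f y (t ^+ N.+1 * C c).
have -> : (t ^+ N.+1 * C c) ^+ 2 * s = t ^+ (N.+1 + N.+1) * (C c ^+ 2 * s).
  by rewrite exprMn -exprM muln2 addnn mulrA.
have Hi : (i < N.+1 + N.+1)%N by lia.
rewrite mulrCA !coefsD !coefsXnM Hi addr0 {Hi}.
move: iN; rewrite leq_eqVlt => /predU1P[->|iN]; last first.
  by rewrite iN addr0 IH.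
rewrite ltnn subnn coefsM0.
rewrite [f^`().[y] _](agree_horner _ (hensel_approx_mod (leq0n N))) //.
rewrite coefs_poly coefC eqxx.
by rewrite mulrN mulrC divfK // coefs0 subrr.
Qed.

(** The coefficients of the root are those of the Newton approximants
    [hensel_approx], each of which fixes one more coefficient. *)
Lemma hensel : exists2 y : series k, y 0%N = y0 & f.[y] = 0.
Proof.
pose y : series k := fun i => hensel_approx i i; exists y.
  by rewrite /y /= coefs_poly coefC.
have yE N : agree N.+1 y (hensel_approx N).
  by move=> i iN; rewrite /y (hensel_approx_mod (_ : i <= N)%N).
apply: funext => N; rewrite (agree_horner f (yE N)) //.
exact: hensel_approx_root.
Qed.
End Hensel.

Lemma series_root (e : nat) (F : series k) (c : k) : e%:R != 0 :> k ->
  c != 0 -> F 0%N = c ^+ e -> exists2 y : series k, y 0%N = c & y ^+ e = F.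
Proof.
case: e => [|e]; first by rewrite eqxx.
move=> e0 c0 Fc.
have E (y : series k) : ('X^(e.+1) - F%:P).[y] = y ^+ e.+1 - F by rewrite !hornerE.
have Cc0 j : (C c ^+ j) 0%N = c ^+ j.
  by rewrite -rmorphXn /= -polyC_exp coefs_poly coefC.
have [||y y0 Hy] := @hensel ('X^(e.+1) - F%:P) c.
- by rewrite E coefsB Cc0 Fc subrr.
- rewrite derivB derivC subr0 derivXn hornerMn hornerXn /=.
  by rewrite coefsMn Cc0 -mulr_natl mulf_neq0 ?expf_neq0.
- by exists y => //; apply/eqP; rewrite -subr_eq0 -E Hy.
Qed.

End SeriesField.

Lemma series_inverse (k : fieldType) (U : series k) : U 0%N != 0 ->
  exists V : series k, V * U = 1.
Proof.
move=> U0; have E (y : series k) : (U%:P * 'X - 1).[y] = U * y - 1 by rewrite !hornerE.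
have [||V _ HV] := @hensel k (U%:P * 'X - 1) (U 0%N)^-1.
- rewrite E coefsB coefsM0 coefs_poly coefC eqxx coefs1_0.
  by rewrite mulfV // subrr.
- rewrite derivB derivM derivX derivC mul0r add0r mulr1.
  by rewrite -polyC1 derivC subr0 hornerC.
- by exists V; apply/eqP; rewrite mulrC -subr_eq0 -E HV.
Qed.

(** * Fields with a valuation and a derivation *)

Lemma log_leibniz (F : fieldType) (a b da db : F) : a != 0 -> b != 0 ->
  (da * b + a * db) / (a * b) = da / a + db / b.
Proof. by move=> a0 b0; field; rewrite a0 b0. Qed.

(** A field over [k] with a normalized valuation [dv_ord] and a derivation
    [dv_deriv] with respect to a uniformizer [dv_var]: the structure of the Laurent
    series that the argument relies on. *)
Record diff_val_field (k : fieldType) := DiffValField {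
  dv_sort :> fieldType;
  dv_const : {rmorphism k -> dv_sort};
  dv_var : dv_sort;
  dv_ord : dv_sort -> int;
  dv_deriv : dv_sort -> dv_sort;
  dv_var_neq0 : dv_var != 0;
  dv_ord_var : dv_ord dv_var = 1;
  dv_ord_const : forall c, c != 0 -> dv_ord (dv_const c) = 0;
  dv_ordM : forall z w, z != 0 -> w != 0 -> dv_ord (z * w) = dv_ord z + dv_ord w;
  dv_ordD : forall N z w, z != 0 -> w != 0 -> z + w != 0 ->
    N <= dv_ord z -> N <= dv_ord w -> N <= dv_ord (z + w);
  dv_derivD : forall z w, dv_deriv (z + w) = dv_deriv z + dv_deriv w;
  dv_derivM : forall z w, dv_deriv (z * w) = dv_deriv z * w + z * dv_deriv w;
  dv_deriv_const : forall c, dv_deriv (dv_const c) = 0;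
  dv_deriv_var : dv_deriv dv_var = 1;
  dv_deriv_unit : forall z, z != 0 -> dv_ord z = 0 -> dv_deriv z != 0 -> 0 <= dv_ord (dv_deriv z)
}.

Arguments dv_const {k d}.
Arguments dv_var {k d}.

Section DiffValTheory.
Variables (k : fieldType) (L : diff_val_field k).
Implicit Types z w : L.
Local Notation t := (dv_var : L).

Lemma dv_ord1 : dv_ord (1 : L) = 0.
Proof.
have /eqP := @dv_ordM _ L 1 1 (oner_neq0 _) (oner_neq0 _).
by rewrite mulr1 -subr_eq0 opprD addNKr oppr_eq0 => /eqP.
Qed.

Lemma dv_ordV z : z != 0 -> dv_ord z^-1 = - dv_ord z.
Proof. by move=> z0; have := @dv_ordM _ L z z^-1 z0; rewrite invr_eq0 mulfV // dv_ord1 => /(_ z0); lia. Qed.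

Lemma dv_ordX z e : z != 0 -> dv_ord (z ^+ e) = dv_ord z * e%:Z.
Proof.
move=> z0; elim: e => [|e IH]; first by rewrite dv_ord1 mulr0.
by rewrite exprS dv_ordM ?expf_neq0 // IH; lia.
Qed.

Lemma dv_ordXz z (i : int) : z != 0 -> dv_ord (z ^ i) = dv_ord z * i.
Proof.
move=> z0; case: i => i; first by rewrite -exprnP dv_ordX.
by rewrite NegzE -exprnN dv_ordV ?expf_neq0 // dv_ordX //; lia.
Qed.

Lemma dv_ordN z : dv_ord (- z) = dv_ord z.
Proof.
have [->|z0] := eqVneq z 0; first by rewrite oppr0.
have N1 : (-1 : L) != 0 by rewrite oppr_eq0 oner_neq0.
rewrite -mulN1r dv_ordM //; suff : dv_ord (-1 : L) + dv_ord (-1 : L) = 0 by lia.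
by rewrite -dv_ordM // mulrNN mulr1 dv_ord1.
Qed.

(** The convention that the valuation of [0] is infinite. *)
Definition vge (N : int) z := z = 0 \/ N <= dv_ord z.

Lemma vge_neq0 N z : z != 0 -> vge N z -> N <= dv_ord z.
Proof. by move=> z0 [z1|//]; rewrite z1 eqxx in z0. Qed.

Lemma vgeM M N z w : vge M z -> vge N w -> vge (M + N) (z * w).
Proof.
have [->|z0] := eqVneq z 0; first by rewrite mul0r; left.
have [->|w0] := eqVneq w 0; first by rewrite mulr0; left.
by move=> /(vge_neq0 z0) ? /(vge_neq0 w0) ?; right; rewrite dv_ordM //; lia.
Qed.

Lemma vgeD N z w : vge N z -> vge N w -> vge N (z + w).
Proof.
have [->|z0] := eqVneq z 0; first by rewrite add0r.
have [->|w0] := eqVneq w 0; first by rewrite addr0.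
have [->|s0] := eqVneq (z + w) 0; first by left.
by move=> /(vge_neq0 z0) Nz /(vge_neq0 w0) Nw; right; apply: dv_ordD.
Qed.

Lemma vge_const c : vge 0 (dv_const c : L).
Proof.
have [->|c0] := eqVneq c 0; first by left; rewrite rmorph0.
by right; rewrite dv_ord_const.
Qed.

Lemma vge_sum N (I : Type) (r : seq I) (P : pred I) (f : I -> L) :
  (forall i, P i -> vge N (f i)) -> vge N (\sum_(i <- r | P i) f i).
Proof. by move=> H; elim/big_ind: _ => //; [left|exact: vgeD]. Qed.

Lemma vgeN N z : vge N z -> vge N (- z).
Proof. by case=> [->|H]; [left; rewrite oppr0|right; rewrite dv_ordN]. Qed.

Lemma vgeW M N z : N <= M -> vge M z -> vge N z.
Proof. by move=> NM [->|H]; [left|right; apply: le_trans H]. Qed.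

(** The term of least valuation cannot be cancelled by the others. *)
Lemma distinct_dv_ord (I : finType) (f : I -> L) :
  (forall i j, f i != 0 -> f j != 0 -> dv_ord (f i) = dv_ord (f j) -> i = j) ->
  \sum_i f i = 0 -> forall i, f i = 0.
Proof.
move=> inj S0 i0; apply/eqP; case: (boolP (f i0 == 0)) => // fi0.
have [i fi min] := @Order.TotalTheory.arg_minP _ _ _ i0 (fun i => f i != 0)
  (fun i => dv_ord (f i)) fi0.
have E : f i = - \sum_(j | j != i) f j.
  by move: S0; rewrite (bigD1 i) //= => /eqP; rewrite addr_eq0 => /eqP.
have : vge (dv_ord (f i) + 1) (f i).
  rewrite {2}E; apply/vgeN/vge_sum => j ji.
  have [->|fj] := eqVneq (f j) 0; first by left.
  right; have := min j fj; rewrite le_eqVlt => /predU1P[e|]; last by lia.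
  by case/eqP: ji; apply: inj.
move/(vge_neq0 fi); lia.
Qed.

Lemma dv_ord_addl z w : z != 0 -> vge (dv_ord z + 1) w -> z + w != 0 /\ dv_ord (z + w) = dv_ord z.
Proof.
move=> z0 Hw; have s0 : z + w != 0.
  apply/eqP => /eqP; rewrite addr_eq0 => /eqP zw.
  by move: Hw => /vgeN; rewrite -zw => /(vge_neq0 z0); lia.
split=> //; apply/eqP; rewrite eq_le; apply/andP; split; last first.
  apply: (vge_neq0 s0); apply: vgeD; first by right.
  by apply: vgeW Hw; lia.
rewrite leNgt; apply/negP => lt.
have : vge (dv_ord z + 1) (z + w - w).
  by apply: vgeD; [right; lia|exact: vgeN].
by rewrite addrK => /(vge_neq0 z0); lia.
Qed.

Lemma dv_deriv0 : dv_deriv (0 : L) = 0.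
Proof. by rewrite -[X in dv_deriv X](rmorph0 (@dv_const k L)) dv_deriv_const. Qed.

Lemma dv_deriv_sum (I : Type) (r : seq I) (P : pred I) (f : I -> L) :
  dv_deriv (\sum_(i <- r | P i) f i) = \sum_(i <- r | P i) dv_deriv (f i).
Proof. by apply: big_morph; [exact: dv_derivD|exact: dv_deriv0]. Qed.

Lemma dv_derivXn z e : dv_deriv (z ^+ e) = z ^+ e.-1 * dv_deriv z *+ e.
Proof.
elim: e => [|e IH]; first by rewrite expr0 mulr0n -(rmorph1 (@dv_const k L)) dv_deriv_const.
rewrite exprS dv_derivM IH /=; case: e {IH} => [|e].
  by rewrite mulr0n mulr0 addr0 expr0 mulrC.
by rewrite /= mulrnAr mulrA -exprS mulrC -mulrS.
Qed.

Definition dlog z := dv_deriv z / z.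

Lemma dlogM z w : z != 0 -> w != 0 -> dlog (z * w) = dlog z + dlog w.
Proof. by move=> z0 w0; rewrite /dlog dv_derivM log_leibniz. Qed.

Lemma dlogX z e : z != 0 -> dlog (z ^+ e) = dlog z *+ e.
Proof.
move=> z0; elim: e => [|e IH]; last by rewrite exprS dlogM ?expf_neq0 // IH mulrS.
by rewrite expr0 mulr0n /dlog -(rmorph1 (@dv_const k L)) dv_deriv_const mul0r.
Qed.

Lemma dlogV z : z != 0 -> dlog z^-1 = - dlog z.
Proof.
move=> z0; apply/eqP; rewrite -addr_eq0 -dlogM ?invr_eq0 // mulVf //.
by rewrite /dlog -(rmorph1 (@dv_const k L)) dv_deriv_const mul0r.
Qed.

Lemma vgeZ N (c : k) z : vge N z -> vge N (dv_const c * z).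
Proof. by move=> H; rewrite -[N]add0r; apply: vgeM => //; exact: vge_const. Qed.

Lemma dlogXz z (i : int) : z != 0 -> dlog (z ^ i) = dlog z *~ i.
Proof.
move=> z0; case: i => i; first by rewrite -exprnP dlogX.
by rewrite NegzE -exprnN dlogV ?expf_neq0 // dlogX // mulrNz.
Qed.

(** Writing [z = t ^ i * u] with [u] a unit gives [dlog z = i / t + dlog u]: a
    logarithmic derivative has at most a simple pole, with residue the order of
    [z], and no pole at all when this order vanishes in [k]. *)
Lemma dlog_regular z : z != 0 -> (dv_ord z)%:~R = 0 :> k -> vge 0 (dlog z).
Proof.
move=> z0 zk; have t0 := dv_var_neq0 L; set i := dv_ord z in zk.
pose u := z * t ^ (- i).
have ti0 : t ^ (- i) != 0 by rewrite expfz_neq0.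
have u0 : u != 0 by rewrite mulf_neq0.
have ou : dv_ord u = 0 by rewrite dv_ordM // dv_ordXz // dv_ord_var mul1r subrr.
have zu : z = u * t ^ i by rewrite /u -mulrA -expfzDr // addNr expr0z mulr1.
have -> : dlog z = dlog u.
  rewrite {1}zu dlogM ?expfz_neq0 // dlogXz // -mulrzr.
  have -> : i%:~R = 0 :> L by rewrite -(rmorph_int (@dv_const k L)) zk rmorph0.
  by rewrite mulr0 addr0.
rewrite /dlog; have [->|d0] := eqVneq (dv_deriv u) 0; first by left; rewrite mul0r.
right; rewrite dv_ordM ?invr_eq0 // dv_ordV // ou subr0.
exact: dv_deriv_unit.
Qed.

End DiffValTheory.

Section Fraction.
Local Open Scope quotient_scope.

Lemma fractionP (R : idomainType) (z : {fraction R}) :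
  exists A B, B != 0 /\ z = FracField.tofrac A / FracField.tofrac B.
Proof.
elim/quotW: z => r; exists \n_r, \d_r; split; first exact: denom_ratioP.
have d0 : FracField.tofrac \d_r != 0 by rewrite tofrac_eq0 denom_ratioP.
apply/(canRL (mulfK d0)).
rewrite -[LHS]/(FracField.mul _ _) !piE. 
apply/eqmodP => /=.
rewrite FracField.equivfE /FracField.mulf !numden_Ratio ?oner_neq0 ?mulr1 ?denom_ratioP //.
by rewrite mulrC.
Qed.

End Fraction.

(** The quotient rule turns the Leibniz rule and additivity for power series into
    the same laws for fractions. *)
Lemma quotient_ruleM (F : fieldType) (a b c d da db dc dd : F) : b != 0 -> d != 0 ->
  ((da * c + a * dc) * (b * d) - a * c * (db * d + b * dd)) / (b * d) ^+ 2 =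
  (da * b - a * db) / b ^+ 2 * (c / d) + a / b * ((dc * d - c * dd) / d ^+ 2).
Proof. by move=> b0 d0; field; rewrite b0 d0. Qed.

Lemma quotient_ruleD (F : fieldType) (a b c d da db dc dd : F) : b != 0 -> d != 0 ->
  ((da * d + a * dd + (dc * b + c * db)) * (b * d)
    - (a * d + c * b) * (db * d + b * dd)) / (b * d) ^+ 2 =
  (da * b - a * db) / b ^+ 2 + (dc * d - c * dd) / d ^+ 2.
Proof. by move=> b0 d0; field; rewrite b0 d0. Qed.

Notation laurent k := {fraction (series k)}.
Notation "F %:L" := (@FracField.tofrac (series _) F)
  (at level 2, left associativity, format "F %:L") : ring_scope.

Section Laurent.
Variable k : fieldType.
Local Notation L := (laurent k).
Implicit Types (A B U V : series k) (z w : L).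

Definition laurent_const (c : k) : L := (series_of_poly c%:P)%:L.
Definition laurent_var : L := (series_of_poly 'X)%:L.
Local Notation t := laurent_var.

Fact laurent_const_zmod : zmod_morphism laurent_const.
Proof. by move=> c d; rewrite /laurent_const !rmorphB. Qed.
Fact laurent_const_monoid : monoid_morphism laurent_const.
Proof. by split=> [|c d]; rewrite /laurent_const ?rmorph1 ?rmorphM. Qed.
HB.instance Definition _ := GRing.isZmodMorphism.Build _ _ laurent_const laurent_const_zmod.
HB.instance Definition _ := GRing.isMonoidMorphism.Build _ _ laurent_const laurent_const_monoid.

Lemma laurent_fracP z : exists A B, B != 0 /\ z = A%:L / B%:L.
Proof. exact: fractionP. Qed.

Lemma frac_eq A B A' B' : B != 0 -> B' != 0 ->
  A%:L / B%:L = A'%:L / B'%:L -> A * B' = A' * B.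
Proof.
move=> B0 B'0 H; apply/eqP; rewrite -(tofrac_eq (A * B')) !rmorphM /=.
by rewrite -eqr_div ?tofrac_eq0 // H.
Qed.

Definition numer z : series k := projT1 (cid (laurent_fracP z)).
Definition denom z : series k := projT1 (cid (projT2 (cid (laurent_fracP z)))).
Lemma numer_denom z : denom z != 0 /\ z = (numer z)%:L / (denom z)%:L.
Proof. exact: projT2 (cid (projT2 (cid (laurent_fracP z)))). Qed.

Definition laurent_ord z : int := (ord_series (numer z))%:Z - (ord_series (denom z))%:Z.

Lemma laurent_ord_frac A B : A != 0 -> B != 0 ->
  laurent_ord (A%:L / B%:L) = (ord_series A)%:Z - (ord_series B)%:Z.
Proof.
move=> A0 B0; set z := _ / _; have [d0 zE] := numer_denom z.
have E : A * denom z = numer z * B by apply: frac_eq.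
have n0 : numer z != 0.
  by apply: contraNneq A0 => n0; move: E => /eqP; rewrite n0 mul0r mulf_eq0 (negbTE d0) orbF.
have := congr1 (@ord_series k) E; rewrite !ord_seriesM // /laurent_ord; lia.
Qed.

Lemma laurent_ord_series A : A != 0 -> laurent_ord A%:L = (ord_series A)%:Z.
Proof.
move=> A0; have := laurent_ord_frac A0 (oner_neq0 (series k)).
rewrite rmorph1 divr1 => ->.
by rewrite (@ord_series_unique _ 0 1 1) ?subr0 // ?expr0 ?mulr1 // coefs1_0 oner_neq0.
Qed.

Lemma laurent_ordM z w : z != 0 -> w != 0 -> laurent_ord (z * w) = laurent_ord z + laurent_ord w.
Proof.
have [A [B [B0 ->]]] := laurent_fracP z; have [A' [B' [B'0 ->]]] := laurent_fracP w.
rewrite !mulf_eq0 !invr_eq0 !tofrac_eq0 !negb_or => /andP[A0 _] /andP[A'0 _].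
by rewrite mulf_div -!rmorphM /= !laurent_ord_frac ?mulf_neq0 //; rewrite !ord_seriesM //; lia.
Qed.

Lemma laurent_ord_const c : c != 0 -> laurent_ord (laurent_const c) = 0.
Proof.
move=> c0; have C0 : series_of_poly c%:P 0%N != 0 by rewrite coefs_poly coefC.
rewrite laurent_ord_series; last by apply: contraNneq C0 => ->; rewrite coefs0.
by rewrite (@ord_series_unique _ 0 _ (series_of_poly c%:P)) // mul1r.
Qed.

Lemma laurent_var_neq0 : t != 0.
Proof.
rewrite tofrac_eq0; apply/eqP => /(congr1 (fun F : series k => F 1%N)).
by rewrite coefs0 coefs_poly coefX => /eqP; rewrite oner_eq0.
Qed.

Lemma laurent_ord_var : laurent_ord t = 1.
Proof.
have := laurent_var_neq0; rewrite tofrac_eq0 => /laurent_ord_series ->.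
by rewrite -[series_of_poly _]expr1 ord_seriesXn.
Qed.

Lemma laurent_ordD N z w : z != 0 -> w != 0 -> z + w != 0 ->
  N <= laurent_ord z -> N <= laurent_ord w -> N <= laurent_ord (z + w).
Proof.
move=> z0 w0 s0.
have [A [B [B0 zE]]] := laurent_fracP z; have [A' [B' [B'0 wE]]] := laurent_fracP w.
have sE : z + w = (A * B' + A' * B)%:L / (B * B')%:L.
  by rewrite zE wE addf_div ?tofrac_eq0 // rmorphD !rmorphM.
have A0 : A != 0 by apply: contraNneq z0 => A0; rewrite zE A0 rmorph0 mul0r.
have A'0 : A' != 0 by apply: contraNneq w0 => A0'; rewrite wE A0' rmorph0 mul0r.
have S0 : A * B' + A' * B != 0 by apply: contraNneq s0 => S0; rewrite sE S0 rmorph0 mul0r.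
rewrite sE zE wE !laurent_ord_frac ?mulf_neq0 // ord_seriesM //.
set a := ord_series A; set b := ord_series B; set a' := ord_series A'; set b' := ord_series B'.
move=> Nz Nw.
have : (minn (a + b') (a' + b) <= ord_series (A * B' + A' * B)%R)%N.
  apply/ord_series_leP => // i; rewrite leq_min => /andP[i1 i2].
  rewrite coefsD.
  have AB' : A * B' != 0 by rewrite mulf_neq0.
  have A'B : A' * B != 0 by rewrite mulf_neq0.
  have -> : (A * B') i = 0.
    have le : (a + b' <= ord_series (A * B')%R)%N by rewrite ord_seriesM.
    by rewrite (iffLR (ord_series_leP _ AB') le) // coefs0.
  have -> : (A' * B) i = 0.
    have le : (a' + b <= ord_series (A' * B)%R)%N by rewrite ord_seriesM.
    by rewrite (iffLR (ord_series_leP _ A'B) le) // coefs0.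
  by rewrite coefs0 addr0.
lia.
Qed.
Definition laurent_deriv z : L :=
  (deriv_series (numer z) * denom z - numer z * deriv_series (denom z))%:L
  / (denom z ^+ 2)%:L.

Lemma laurent_deriv_frac A B : B != 0 -> laurent_deriv (A%:L / B%:L) =
  (deriv_series A * B - A * deriv_series B)%:L / (B ^+ 2)%:L.
Proof.
move=> B0; set z := _ / _; have [d0 zE] := numer_denom z.
have E : A * denom z = numer z * B by apply: frac_eq.
apply/eqP; rewrite eqr_div ?tofrac_eq0 ?expf_neq0 // -!rmorphM /= tofrac_eq.
have := congr1 (@deriv_series k) E; rewrite !deriv_seriesM.
move: (numer z) (denom z) E {zE d0} => a b E E'; apply/eqP.
transitivity (B * (deriv_series a * B + a * deriv_series B) * b
   - a * B * deriv_series b * B - (a * B) * (deriv_series B * b) ); first by ring.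
by rewrite -E' -E; ring.
Qed.

Lemma laurent_derivM z w : laurent_deriv (z * w) = laurent_deriv z * w + z * laurent_deriv w.
Proof.
have [A [B [B0 ->]]] := laurent_fracP z; have [A' [B' [B'0 ->]]] := laurent_fracP w.
rewrite mulf_div -!rmorphM /= !laurent_deriv_frac ?mulf_neq0 // !deriv_seriesM.
rewrite !rmorphXn !(rmorphB, rmorphM, rmorphD) /=.
by apply: quotient_ruleM; rewrite tofrac_eq0.
Qed.

Lemma laurent_derivD z w : laurent_deriv (z + w) = laurent_deriv z + laurent_deriv w.
Proof.
have [A [B [B0 ->]]] := laurent_fracP z; have [A' [B' [B'0 ->]]] := laurent_fracP w.
rewrite addf_div ?tofrac_eq0 // -!rmorphM -rmorphD /= !laurent_deriv_frac ?mulf_neq0 //.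
rewrite deriv_seriesD !deriv_seriesM.
rewrite !rmorphXn !(rmorphB, rmorphM, rmorphD) /=.
by apply: quotient_ruleD; rewrite tofrac_eq0.
Qed.

Lemma laurent_deriv_series A : laurent_deriv A%:L = (deriv_series A)%:L.
Proof.
rewrite -[A%:L]divr1 -(rmorph1 (@FracField.tofrac (series k))) laurent_deriv_frac ?oner_neq0 //.
by rewrite deriv_series1 mulr0 subr0 mulr1 expr1n rmorph1 divr1.
Qed.

Lemma laurent_deriv_const c : laurent_deriv (laurent_const c) = 0.
Proof. by rewrite laurent_deriv_series deriv_series_poly derivC !rmorph0. Qed.

Lemma laurent_deriv_var : laurent_deriv t = 1.
Proof. by rewrite laurent_deriv_series deriv_series_poly derivX !rmorph1. Qed.

Lemma laurent_deriv_unit z : z != 0 -> laurent_ord z = 0 -> laurent_deriv z != 0 -> 0 <= laurent_ord (laurent_deriv z).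
Proof.
have [A [B [B0 zE]]] := laurent_fracP z => z0.
have A0 : A != 0 by apply: contraNneq z0 => A0; rewrite zE A0 rmorph0 mul0r.
rewrite zE laurent_ord_frac //.
have [U U0 AE] := ord_seriesP A0; have [V V0 BE] := ord_seriesP B0.
move=> /eqP; rewrite subr_eq0 => /eqP[AB].
have V1 : V != 0 by apply: contraNneq V0 => ->; rewrite coefs0.
have -> : A%:L / B%:L = U%:L / V%:L.
  apply/eqP; rewrite eqr_div ?tofrac_eq0 // -!rmorphM tofrac_eq; apply/eqP.
  by rewrite AE BE AB; ring.
rewrite laurent_deriv_frac //; set W := (_ - _) => d0.
have W0 : W != 0 by apply: contraNneq d0 => ->; rewrite rmorph0 mul0r.
rewrite laurent_ord_frac ?expf_neq0 // (@ord_series_unique _ 0 (V ^+ 2) (V ^+ 2)) ?subr0 //.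
  by rewrite expr0 mul1r.
by rewrite expr2 coefsM0 mulf_neq0.
Qed.

Definition laurent_dv : diff_val_field k := @DiffValField k L laurent_const laurent_var
  laurent_ord laurent_deriv laurent_var_neq0 laurent_ord_var laurent_ord_const
  laurent_ordM laurent_ordD laurent_derivD laurent_derivM laurent_deriv_const
  laurent_deriv_var laurent_deriv_unit.

End Laurent.

(** * The function field *)

Lemma exists_rmorphism (R S : nzRingType) (f : R -> S) :
  zmod_morphism f -> monoid_morphism f -> exists phi : {rmorphism R -> S}, phi =1 f.
Proof.
move=> fa fm.
pose fA := GRing.isZmodMorphism.Build R S f fa.
pose fM := GRing.isMonoidMorphism.Build R S f fm.
pose F : {rmorphism R -> S} := HB.pack f fA fM.
by exists F.
Qed.

Section Evaluation.
Variables (k L : comNzRingType) (kappa : {rmorphism k -> L}).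

Definition ev1 (a : L) (N : {poly k}) : L := (map_poly kappa N).[a].
Definition ev2 (a b : L) (P : {poly {poly k}}) : L :=
  (map_poly (map_poly kappa) P).[a, b].

Fact ev1_zmod a : zmod_morphism (ev1 a).
Proof. by move=> P Q; rewrite /ev1 rmorphB hornerD hornerN. Qed.
Fact ev1_monoid a : monoid_morphism (ev1 a).
Proof. by split=> [|P Q]; rewrite /ev1 ?rmorph1 ?hornerC // rmorphM hornerM. Qed.
HB.instance Definition _ a := GRing.isZmodMorphism.Build _ _ (ev1 a) (ev1_zmod a).
HB.instance Definition _ a := GRing.isMonoidMorphism.Build _ _ (ev1 a) (ev1_monoid a).

Fact ev2_zmod a b : zmod_morphism (ev2 a b).
Proof. by move=> P Q; rewrite /ev2 rmorphB !hornerE. Qed.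
Fact ev2_monoid a b : monoid_morphism (ev2 a b).
Proof. by split=> [|P Q]; rewrite /ev2 ?rmorph1 ?hornerC // rmorphM !hornerM. Qed.
HB.instance Definition _ a b := GRing.isZmodMorphism.Build _ _ (ev2 a b) (ev2_zmod a b).
HB.instance Definition _ a b := GRing.isMonoidMorphism.Build _ _ (ev2 a b) (ev2_monoid a b).

Lemma ev2N a b P : ev2 a b (- P) = - ev2 a b P.
Proof. by rewrite -sub0r ev2_zmod rmorph0 sub0r. Qed.

Lemma ev1N a P : ev1 a (- P) = - ev1 a P.
Proof. by rewrite -sub0r ev1_zmod rmorph0 sub0r. Qed.

Lemma ev1X a : ev1 a 'X = a. Proof. by rewrite /ev1 map_polyX hornerX. Qed.
Lemma ev1C a c : ev1 a c%:P = kappa c. Proof. by rewrite /ev1 map_polyC hornerC. Qed.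
Lemma ev2X a b : ev2 a b 'X = a.
Proof. by rewrite /ev2 map_polyX hornerX hornerC. Qed.
Lemma ev2Y a b : ev2 a b 'Y = b.
Proof. by rewrite /ev2 map_polyC /= map_polyX hornerC hornerX. Qed.
Lemma ev2C a b c : ev2 a b c%:P%:P = kappa c.
Proof. by rewrite /ev2 map_polyC /= map_polyC !hornerC. Qed.

Lemma ev1_ind (S : L -> Prop) a : (forall c, S (kappa c)) -> S a ->
  (forall u v, S u -> S v -> S (u + v)) -> (forall u v, S u -> S v -> S (u * v)) ->
  forall N, S (ev1 a N).
Proof.
move=> SC Sa SD SM; elim/poly_ind => [|N c IH].
  by rewrite rmorph0 -(rmorph0 kappa); apply: SC.
by rewrite rmorphD rmorphM /= ev1X ev1C; apply: SD => //; apply: SM.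
Qed.

Lemma ev2_ind (S : L -> Prop) a b : (forall c, S (kappa c)) -> S a -> S b ->
  (forall u v, S u -> S v -> S (u + v)) -> (forall u v, S u -> S v -> S (u * v)) ->
  forall P, S (ev2 a b P).
Proof.
move=> SC Sa Sb SD SM; elim/poly_ind => [|P N IH].
  by rewrite rmorph0 -(rmorph0 kappa); apply: SC.
rewrite rmorphD rmorphM /= ev2X; apply: (SD); first exact: SM.
have -> : ev2 a b N%:P = ev1 b N by rewrite /ev2 map_polyC /= hornerC.
exact: (ev1_ind SC Sb SD SM).
Qed.
End Evaluation.

(** Over an algebraically closed field a transcendental element is just a
    nonconstant one: factor [N] into linear terms. *)
Lemma ev1_root_factor (k : closedFieldType) (L : fieldType)
  (kappa : {rmorphism k -> L}) (a : L) (N : {poly k}) :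
  (forall c, a != kappa c) -> N != 0 -> ev1 kappa a N != 0.
Proof.
move=> tr; have [s] := ubnP (size N); elim: s N => // s IH N Ns N0.
have [sN1|sN1] := eqVneq (size N) 1%N.
  have [c c0 ->] := size_poly1P _ (introT eqP sN1).
  by rewrite ev1C fmorph_eq0.
have [c /factor_theorem[Q NE]] := closed_rootP N sN1.
have Q0 : Q != 0 by apply: contraNneq N0 => Q0; rewrite NE Q0 mul0r.
rewrite NE rmorphM rmorphB /= ev1X ev1C mulf_neq0 ?subr_eq0 //.
apply: IH => //; move: Ns; rewrite NE size_Mmonic ?monicXsubC // size_XsubC addn2 /=.
by [].
Qed.

Section FunctionField.
Variables (k : closedFieldType) (K : fieldType) (iota : {rmorphism k -> K}).
Variables (n m : nat) (x y : K).
Hypotheses (n0 : (0 < n)%N) (m0 : (0 < m)%N).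
Hypothesis K_fun : is_function_field iota (fermat_curve k n m) x y.
Local Notation ev := (ev2 iota x y).
Local Notation atX := (ev1 iota (x ^+ n)).

Lemma ev_fermat (L : comNzRingType) (kappa : {rmorphism k -> L}) a b :
  ev2 kappa a b (fermat_curve k n m) = b ^+ m - (a ^+ n + 1).
Proof.
by rewrite /fermat_curve ev2_zmod rmorphD !rmorphXn rmorph1 /= ev2X ev2Y.
Qed.

Lemma fermat_eq : y ^+ m = x ^+ n + 1.
Proof.
apply/eqP; rewrite -subr_eq0 -(ev_fermat iota); apply/eqP/(K_fun.1 _).
by exists 1; rewrite mul1r.
Qed.

Lemma ev_frac z : exists P Q, ev Q != 0 /\ z = ev P / ev Q.
Proof. exact: K_fun.2. Qed.

Lemma subfield_ind (S : K -> Prop) : (forall c, S (iota c)) -> S x -> S y ->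
  (forall u v, S u -> S v -> S (u + v)) -> (forall u v, S u -> S v -> S (u * v)) ->
  (forall u, u != 0 -> S u -> S u^-1) -> forall z, S z.
Proof.
move=> SC Sx Sy SD SM SV z; have [P [Q [Q0 ->]]] := ev_frac z.
have Sev := ev2_ind SC Sx Sy SD SM.
by apply: SM; [|apply: SV].
Qed.

Definition regular z := exists P, z = ev P.

Lemma regularD u v : regular u -> regular v -> regular (u + v).
Proof. by move=> [P ->] [Q ->]; exists (P + Q); rewrite rmorphD. Qed.
Lemma regularM u v : regular u -> regular v -> regular (u * v).
Proof. by move=> [P ->] [Q ->]; exists (P * Q); rewrite rmorphM. Qed.
Lemma regular_const c : regular (iota c).
Proof. by exists c%:P%:P; rewrite ev2C. Qed.
Lemma regular_atX N : regular (atX N).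
Proof.
apply: ev1_ind; [exact: regular_const| |exact: regularD|exact: regularM].
by exists ('X ^+ n); rewrite rmorphXn /= ev2X.
Qed.

Lemma integral_ev P : integralOver atX (ev P).
Proof.
apply: ev2_ind => [c|||u v|u v].
- by rewrite -(ev1C iota (x ^+ n)); apply: integral_id.
- apply: (@integral_root_monic _ _ _ _ ('X^n - (x ^+ n)%:P)).
  + by rewrite monicXnsubC.
  + by rewrite /root !hornerE subrr.
  + apply/integral_poly => i; rewrite coefB coefXn coefC.
    apply: integral_sub; first exact: integral_nat.
    by case: ifP => _; [rewrite -{2}(ev1X iota (x ^+ n))|rewrite -(rmorph0 atX)]; apply: integral_id.
- apply: (@integral_root_monic _ _ _ _ ('X^m - (y ^+ m)%:P)).
  + by rewrite monicXnsubC.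
  + by rewrite /root !hornerE subrr.
  + apply/integral_poly => i; rewrite coefB coefXn coefC.
    apply: integral_sub; first exact: integral_nat.
    case: ifP => _; last by rewrite -(rmorph0 atX); apply: integral_id.
    rewrite fermat_eq -[X in X + 1](ev1X iota (x ^+ n)) -(rmorph1 atX) -rmorphD.
    exact: integral_id.
- exact: integral_add.
- exact: integral_mul.
Qed.

(** The constant term of an integral equation of [ev Q] over [k[x ^ n]], once the
    powers of [ev Q] are cancelled, is a nonzero multiple of [ev Q].  It plays the
    part of the norm from [K] to [k(x ^ n)], and shows that denominators can be
    taken in [k[x ^ n]]. *)
Lemma regular_divides Q : ev Q != 0 ->
  exists S N, N != 0 /\ ev Q * ev S = atX N.
Proof.
move=> Q0; have [chi chi_mon] := integral_ev Q.
move: (monic_neq0 chi_mon) => {chi_mon}; elim/poly_ind: chi => [|chi c IH].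
  by rewrite eqxx.
move=> chi0; rewrite rmorphD rmorphM /= map_polyX map_polyC rootE hornerMXaddC.
have [c0|c0] := eqVneq c 0.
  rewrite c0 /= rmorph0 addr0 mulf_eq0 (negbTE Q0) orbF; apply: IH.
  by apply: contraNneq chi0 => ->; rewrite c0 mul0r addr0.
rewrite addr_eq0 => /eqP /= E.
have [P HP] : regular (map_poly atX chi).[ev Q].
  elim/poly_ind: chi {IH E chi0} => [|p d IH].
    by rewrite rmorph0 horner0; exists 0; rewrite rmorph0.
  rewrite rmorphD rmorphM /= map_polyX map_polyC hornerMXaddC.
  apply: regularD; last exact: regular_atX.
  by apply: regularM => //; exists Q.
exists P, (- c); split; first by rewrite oppr_eq0.
by rewrite ev1N -HP mulrC E.
Qed.

(** A nonconstant point of the curve with values in [L] is generic.  If a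
    polynomial vanishes at it but not at [(x, y)], then by [regular_divides] a
    nonzero polynomial in [a ^+ n] vanishes, which is impossible. *)
Lemma ext_rmorphism (L : fieldType) (kappa : {rmorphism k -> L}) (a b : L) :
  b ^+ m = a ^+ n + 1 -> (forall c, a ^+ n != kappa c) ->
  exists phi : {rmorphism K -> L},
    [/\ forall c, phi (iota c) = kappa c, phi x = a & phi y = b].
Proof.
move=> ab tr; pose ev' := ev2 kappa a b.
have ev'0 P : ev P = 0 -> ev' P = 0.
  move/(K_fun.1 P) => [Q ->]; rewrite /ev' rmorphM /= ev_fermat ab subrr mulr0.
  by [].
have ev'N P : ev P != 0 -> ev' P != 0.
  move=> /regular_divides[S [N [N0 E]]].
  have E' : ev' P * ev' S = ev1 kappa (a ^+ n) N.
    have HN : forall M, exists M', ev M' = atX M /\ ev' M' = ev1 kappa (a ^+ n) M.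
      elim/poly_ind => [|M c [M' [e1 e2]]].
        by exists 0; rewrite /ev' !rmorph0.
      exists (M' * 'X ^+ n + c%:P%:P); rewrite /ev' !(rmorphD, rmorphM) !rmorphXn /=.
      by rewrite !ev2X !ev2C !ev1X !ev1C -e1 -e2.
    have [N' [e1 e2]] := HN N; rewrite -e2 -rmorphM; apply/eqP; rewrite -subr_eq0 -ev2_zmod.
    by apply/eqP/ev'0; rewrite ev2_zmod rmorphM /= E e1 subrr.
  apply/negP => /eqP P0; have := ev1_root_factor tr N0.
  by rewrite -E' P0 mul0r eqxx.
have frac z : {PQ | ev PQ.2 != 0 /\ z = ev PQ.1 / ev PQ.2}.
  by apply: cid; have [P [Q H]] := ev_frac z; exists (P, Q).
pose f z := let PQ := sval (frac z) in ev' PQ.1 / ev' PQ.2.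
have fE P Q : ev Q != 0 -> f (ev P / ev Q) = ev' P / ev' Q.
  move=> Q0; rewrite /f; case: (frac _) => -[P1 Q1] /= [Q10 E].
  apply/eqP; rewrite eqr_div ?ev'N // -!rmorphM -subr_eq0 -ev2_zmod.
  apply/eqP/ev'0; rewrite ev2_zmod !rmorphM /=; apply/eqP; rewrite subr_eq0.
  by rewrite -eqr_div // E.
have fP P : f (ev P) = ev' P.
  by have := fE P 1; rewrite /ev' !rmorph1 !divr1 oner_neq0; apply.
have fa : zmod_morphism f.
  move=> u v; have [P [Q [Q0 ->]]] := ev_frac u; have [P' [Q' [Q'0 ->]]] := ev_frac v.
  rewrite -mulNr addf_div // -!ev2N -!rmorphM -rmorphD /= !fE ?rmorphM ?mulf_neq0 //.
  by rewrite -mulNr addf_div ?ev'N // /ev' rmorphD !rmorphM /= ev2N.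
have fm : monoid_morphism f.
  split=> [|u v]; first by rewrite -(rmorph1 ev) fP /ev' rmorph1.
  have [P [Q [Q0 ->]]] := ev_frac u; have [P' [Q' [Q'0 ->]]] := ev_frac v.
  rewrite mulf_div -!rmorphM /= !fE ?rmorphM ?mulf_neq0 //=.
  by rewrite /ev' !rmorphM mulf_div.
have [phi phiE] := exists_rmorphism fa fm; exists phi.
split=> [c||]; rewrite phiE.
- by rewrite -(ev2C iota x y) fP /ev' ev2C.
- by have := fP 'X; rewrite /ev' !ev2X.
- by have := fP 'Y; rewrite /ev' !ev2Y.
Qed.

Definition fermat_span z := exists s : 'I_n -> 'I_m -> {poly k},
  z = \sum_i \sum_j atX (s i j) * x ^+ i * y ^+ j.

Lemma fermat_spanD u v : fermat_span u -> fermat_span v -> fermat_span (u + v).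
Proof.
move=> [s ->] [s' ->]; exists (fun i j => s i j + s' i j).
rewrite -big_split; apply: eq_bigr => i _; rewrite -big_split; apply: eq_bigr => j _.
by rewrite /= rmorphD -!mulrDl.
Qed.

Lemma fermat_span0 : fermat_span 0.
Proof.
exists (fun _ _ => 0); rewrite big1 // => i _; rewrite big1 // => j _.
by rewrite rmorph0 !mul0r.
Qed.

Lemma fermat_span_sum (I : Type) (r : seq I) (P : pred I) (f : I -> K) :
  (forall i, P i -> fermat_span (f i)) -> fermat_span (\sum_(i <- r | P i) f i).
Proof. by move=> H; elim/big_ind: _ => //; [exact: fermat_span0|exact: fermat_spanD]. Qed.

Lemma fermat_span_monomial N a b : fermat_span (atX N * x ^+ a * y ^+ b).
Proof.
have an : (a %% n < n)%N by rewrite ltn_mod.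
have bm : (b %% m < m)%N by rewrite ltn_mod.
pose N' := N * 'X ^+ (a %/ n) * ('X + 1) ^+ (b %/ m).
exists (fun i j => if (i == Ordinal an) && (j == Ordinal bm) then N' else 0).
rewrite (bigD1 (Ordinal an)) //= [X in _ + X]big1 ?addr0; last first.
  by move=> i /negPf ->; rewrite big1 // => j _; rewrite rmorph0 !mul0r.
rewrite (bigD1 (Ordinal bm)) //= !eqxx [X in _ + X]big1 ?addr0 => [|j /negPf ->]; last first.
  by rewrite rmorph0 !mul0r.
rewrite /N' !rmorphM !rmorphXn rmorphD rmorph1 /= ev1X -fermat_eq -!exprM.
rewrite {1}(divn_eq a n) {1}(divn_eq b m) !exprD ![(n * _)%N]mulnC ![(m * _)%N]mulnC.
ring.
Qed.

Lemma fermat_spanM u v : fermat_span u -> fermat_span v -> fermat_span (u * v).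
Proof.
move=> [s ->] [s' ->]; rewrite big_distrl; apply: fermat_span_sum => i _ /=.
rewrite big_distrl; apply: fermat_span_sum => j _ /=; rewrite big_distrr.
apply: fermat_span_sum => i' _ /=; rewrite big_distrr; apply: fermat_span_sum => j' _ /=.
have -> : atX (s i j) * x ^+ i * y ^+ j * (atX (s' i' j') * x ^+ i' * y ^+ j') =
   atX (s i j * s' i' j') * x ^+ (i + i') * y ^+ (j + j').
  by rewrite rmorphM !exprD /=; ring.
exact: fermat_span_monomial.
Qed.

Lemma fermat_span_ev P : fermat_span (ev P).
Proof.
apply: ev2_ind; [|have := fermat_span_monomial 1 1 0|have := fermat_span_monomial 1 0 1|exact: fermat_spanD|exact: fermat_spanM].
- move=> c; have := fermat_span_monomial c%:P 0 0; by rewrite ev1C !mulr1.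
- by rewrite rmorph1 mul1r mulr1.
- by rewrite rmorph1 !mul1r.
Qed.

Lemma fermat_span_denominator z : exists2 N, N != 0 & fermat_span (atX N * z).
Proof.
have [P [Q [Q0 ->]]] := ev_frac z; have [S [N [N0 E]]] := regular_divides Q0.
exists N => //; rewrite -E [X in fermat_span X](_ : _ = ev P * ev S).
  by apply: fermat_spanM; exact: fermat_span_ev.
by rewrite mulrC mulrA divfK.
Qed.

Section Frobenius.
Variable p : nat.
Hypotheses (pK : p \in [pchar K]) (m_cop : coprime m p).

Definition pth_span z := exists a : 'I_p -> K, z = \sum_(s < p) x ^+ s * a s ^+ p.

Lemma Frob_add (u v : K) : (u + v) ^+ p = u ^+ p + v ^+ p.
Proof. by rewrite -!(pFrobenius_autE pK) rmorphD. Qed.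

Lemma pth_spanD u v : pth_span u -> pth_span v -> pth_span (u + v).
Proof.
move=> [a ->] [b ->]; exists (fun s => a s + b s); rewrite -big_split.
by apply: eq_bigr => s _; rewrite Frob_add mulrDr.
Qed.

Lemma pth_span_monomial e a : pth_span (x ^+ e * a ^+ p).
Proof.
have p0 := prime_gt0 (pcharf_prime pK).
have ep : (e %% p < p)%N by rewrite ltn_mod.
exists (fun s => if s == Ordinal ep then x ^+ (e %/ p) * a else 0).
rewrite (bigD1 (Ordinal ep)) //= eqxx big1 ?addr0 => [|s /negPf ->]; last first.
  by rewrite expr0n eqn0Ngt p0 mulr0.
by rewrite exprMn -exprM mulrA -exprD addnC -divn_eq.
Qed.

Lemma pth_span_sum (I : Type) (r : seq I) (P : pred I) (f : I -> K) :
  (forall i, P i -> pth_span (f i)) -> pth_span (\sum_(i <- r | P i) f i).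
Proof.
move=> H; elim/big_ind: _ => //; last exact: pth_spanD.
have := pth_span_monomial 0 0.
by rewrite [0 ^+ p]expr0n eqn0Ngt (prime_gt0 (pcharf_prime pK)) mulr0.
Qed.

Lemma pth_spanM u v : pth_span u -> pth_span v -> pth_span (u * v).
Proof.
move=> [a ->] [b ->]; rewrite big_distrl; apply: pth_span_sum => s _ /=.
rewrite big_distrr; apply: pth_span_sum => s' _ /=.
rewrite mulrACA -exprD -exprMn; exact: pth_span_monomial.
Qed.

Lemma pth_span_pow a : pth_span (a ^+ p).
Proof. by rewrite -[a ^+ p]mul1r -(expr0 x); exact: pth_span_monomial. Qed.

Lemma pth_spanX u e : pth_span u -> pth_span (u ^+ e).
Proof.
move=> Hu; elim: e => [|e IH]; last by rewrite exprS; apply: pth_spanM.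
by rewrite expr0 -(expr1n _ p); exact: pth_span_pow.
Qed.

Lemma pth_spanV u : u != 0 -> pth_span u -> pth_span u^-1.
Proof.
move=> u0 Hu; have -> : u^-1 = u ^+ p.-1 * u^-1 ^+ p.
  have p0 := prime_gt0 (pcharf_prime pK).
  by rewrite -{2}(prednK p0) exprS mulrCA -exprMn mulfV // expr1n mulr1.
by apply: pth_spanM; [exact: pth_spanX|exact: pth_span_pow].
Qed.

(** The elements of this form are a subfield: [z^-1 = z ^+ p.-1 * (z^-1) ^+ p].  It
    contains [k], which is perfect, and [y], because [m] is prime to [p] and
    [y ^+ m] is a polynomial in [x]. *)
Lemma pth_span_all z : pth_span z.
Proof.
have p0 := prime_gt0 (pcharf_prime pK).
have Sx : pth_span x by have := pth_span_monomial 1 1; rewrite expr1n mulr1.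
apply: subfield_ind => //; [| |exact: pth_spanD|exact: pth_spanM|exact: pth_spanV].
- move=> c; have [d dc] : exists d : k, d ^+ p = c.
    have [|d] := @closed_rootP k ('X^p - c%:P) _; first by rewrite size_XnsubC // eqSS -lt0n.
    by rewrite rootE !hornerE subr_eq0 => /eqP <-; exists d.
  by rewrite -dc rmorphXn; exact: pth_span_pow.
- have [a b ab _] := egcdnP p m0.
  have Hy : pth_span (y ^+ m).
    by rewrite fermat_eq; apply: pth_spanD; [exact: pth_spanX|rewrite -(expr1n _ p); exact: pth_span_pow].
  have [y0|y0] := eqVneq y 0; first by have := pth_span_pow y; rewrite y0 expr0n eqn0Ngt p0.
  have -> : y = (y ^+ m) ^+ a * (y ^- b) ^+ p.
    rewrite exprVn -!exprM [(m * a)%N]mulnC ab (eqP m_cop) addn1 exprS.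
    by rewrite mulfK // expf_neq0.
  by apply: pth_spanM; [exact: pth_spanX|exact: pth_span_pow].
Qed.
End Frobenius.
End FunctionField.

(** * Places, embeddings and logarithmic derivatives *)

Section PlaceOfEmbedding.
Variables (k : closedFieldType) (K : fieldType) (iota : {rmorphism k -> K}).
Variables (L : diff_val_field k) (phi : {rmorphism K -> L}).
Hypothesis phi_const : forall c, phi (iota c) = dv_const c.

(** The valuations of the elements of [K] form a nonzero subgroup of the integers;
    dividing by its positive generator [e] normalizes the valuation.  Thus
    ramified embeddings, which need no uniformizer of [K], are good enough to test
    the orders of a function. *)
Lemma place_of_embedding z0 : z0 != 0 -> dv_ord (phi z0) != 0 ->
  exists (P : place iota) (e : int), forall z, z != 0 -> dv_ord (phi z) = e * ord P z.
Proof.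
move=> z00 v0.
have phi0 z : z != 0 -> phi z != 0 by rewrite fmorph_eq0.
pose good d := (0 < d)%N && `[< exists2 z, z != 0 & dv_ord (phi z) = d%:Z >].
have [e [e0 [w w0 we]] emin] : exists2 e, (0 < e)%N /\ (exists2 z, z != 0 & dv_ord (phi z) = e%:Z) &
    forall d, good d -> (e <= d)%N.
  have ex : exists d, good d.
    exists `|dv_ord (phi z0)|%N; rewrite /good absz_gt0 v0; apply/asboolP.
    have [ge|lt] := leP 0 (dv_ord (phi z0)); first by exists z0 => //; rewrite gez0_abs.
    exists z0^-1; first by rewrite invr_eq0.
    by rewrite fmorphV dv_ordV ?phi0 // ltz0_abs.
  case: (ex_minnP ex) => e /andP[e0 /asboolP He] emin.
  by exists e.
have dv z : z != 0 -> dv_ord (phi z) = e%:Z * (dv_ord (phi z) %/ e)%Z.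
  move=> nz; set l := dv_ord _.
  have wz0 : z * w ^ (- (l %/ e)%Z) != 0 by rewrite mulf_neq0 ?expfz_neq0.
  have r : dv_ord (phi (z * w ^ (- (l %/ e)%Z))) = (l %% e)%Z.
    rewrite rmorphM rmorphXz ?unitfE //= dv_ordM ?expfz_neq0 ?phi0 // dv_ordXz ?phi0 // we.
    by rewrite -/l mulrN mulrC; apply/eqP; rewrite subr_eq addrC -divz_eq.
  have [r0|rn0] := eqVneq (l %% e)%Z 0; first by rewrite {1}(divz_eq l e) r0 addr0 mulrC.
  have rge : (0 <= l %% e)%Z by apply: modz_ge0; rewrite -lt0n.
  have := emin `|(l %% e)%Z|%N; rewrite /good absz_gt0 rn0 /=.
  have -> : `[< exists2 z, z != 0 & dv_ord (phi z) = `|(l %% e)%Z|%N%:Z >].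
    by apply/asboolP; exists (z * w ^ (- (l %/ e)%Z)) => //; rewrite r gez0_abs.
  move=> /(_ isT).
  have : (l %% e)%Z < e%:Z by apply: ltz_pmod; rewrite ltz_nat.
  lia.
(* The value at [0] is the convention of [place]. *)
pose od z : int := if z == 0 then 0 else (dv_ord (phi z) %/ e)%Z.
have odE z : z != 0 -> e%:Z * od z = dv_ord (phi z).
  by move=> nz; rewrite /od (negbTE nz) -dv.
have ez : e%:Z != 0 by rewrite -lt0n.
have o0 : od 0 = 0 by rewrite /od eqxx.
have oM f g : f != 0 -> g != 0 -> od (f * g) = od f + od g.
  move=> f0 g0; apply: (mulfI ez); rewrite mulrDr !odE ?mulf_neq0 //.
  by rewrite rmorphM dv_ordM ?phi0.
have oD f g : f != 0 -> g != 0 -> f + g != 0 -> Num.min (od f) (od g) <= od (f + g).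
  move=> f0 g0 s0; rewrite -(ler_pM2l (_ : 0 < e%:Z)) ?ltz_nat // odE // rmorphD.
  have := @vgeD _ L (e%:Z * Num.min (od f) (od g)) (phi f) (phi g).
  case.
  - right; rewrite -odE // ler_pM2l ?ltz_nat // ge_min lexx //.
  - right; rewrite -odE // ler_pM2l ?ltz_nat // ge_min lexx orbT //.
  - by move/eqP; rewrite -rmorphD fmorph_eq0 (negbTE s0).
  - by [].
have oC c : c != 0 -> od (iota c) = 0.
  move=> c0; apply: (mulfI ez); rewrite odE ?fmorph_eq0 // phi_const dv_ord_const //.
  by rewrite mulr0.
have oU : exists s, od s = 1.
  by exists w; apply: (mulfI ez); rewrite odE // we mulr1.
by exists (Place o0 oM oD oC oU), e%:Z => z nz; rewrite odE.
Qed.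
End PlaceOfEmbedding.

Section RootFilter.
Variables (k : fieldType) (L : diff_val_field k) (n r : nat) (zeta : k).
Hypotheses (n0 : n%:R != 0 :> k) (zetaP : n.-primitive_root zeta).

Lemma sum_root_unity e : \sum_(a < n) (zeta ^+ e) ^+ a = if (n %| e)%N then n%:R else 0.
Proof.
case: ifP => ne.
  have -> : zeta ^+ e = 1 by apply/eqP; rewrite -(prim_order_dvd zetaP).
  rewrite (eq_bigr (fun=> 1)) => [|a _]; last by rewrite expr1n.
  by rewrite sumr_const card_ord.
have z1 : zeta ^+ e - 1 != 0 by rewrite subr_eq0 -(prim_order_dvd zetaP) ne.
apply: (mulfI z1); rewrite -subrX1 -exprM mulnC exprM (prim_expr_order zetaP).
by rewrite expr1n subrr mulr0.
Qed.

(** Orthogonality of characters: averaging against [zeta ^- (a * (i + r))]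
    isolates the component [V i], and [n] is invertible. *)
Lemma root_filter (M : int) (V : 'I_n -> L) :
  (forall a, vge M (\sum_(i < n) dv_const (zeta ^+ (a * (i + r))) * V i)) ->
  forall i, vge M (V i).
Proof.
move=> H i0.
have E : V i0 = dv_const n%:R^-1 * \sum_(a < n) dv_const (zeta ^+ (a * (n.-1 * (i0 + r)))) *
    \sum_(i < n) dv_const (zeta ^+ (a * (i + r))) * V i.
  under eq_bigr do rewrite big_distrr /=.
  rewrite exchange_big /= (bigD1 i0) //= [X in _ + X]big1 ?addr0 => [|i ii0].
    under eq_bigr do rewrite mulrA -rmorphM -exprD -mulnDr mulnC exprM.
    rewrite -big_distrl /= -rmorph_sum sum_root_unity.
    have np : (0 < n)%N by apply: prim_order_gt0 zetaP.
    rewrite -{2}[(i0 + r)%N]mul1n -mulnDl addn1 prednK // dvdn_mulr //.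
    by rewrite mulrA -rmorphM mulVf // rmorph1 mul1r.
  under eq_bigr do rewrite mulrA -rmorphM -exprD -mulnDr mulnC exprM.
  rewrite -big_distrl /= -rmorph_sum sum_root_unity ifF ?rmorph0 ?mul0r //.
  apply/negP => d; case/eqP: ii0; apply: val_inj => /=.
  have np : (0 < n)%N by apply: prim_order_gt0 zetaP.
  have d2 : (n.-1 * (i0 + r) + (i + r) + (i0 + r) = (i + r) + n * (i0 + r))%N.
    have -> : (n * (i0 + r) = n.-1 * (i0 + r) + (i0 + r))%N by rewrite -mulSnr prednK.
    by rewrite addnAC addnC addnA.
  have : (i + r = i0 + r %[mod n])%N.
    by rewrite -(modnMDl (i0 + r) (i + r)) [(_ * n)%N]mulnC addnC -d2 -modnDml (eqP d).
  by move/eqP; rewrite eqn_modDr !modn_small // => /eqP.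
rewrite E -[M]add0r; apply: vgeM; first exact: vge_const.
apply: vge_sum => a _; rewrite -[M]add0r; apply: vgeM; first exact: vge_const.
exact: H.
Qed.
End RootFilter.

Lemma expr_dlog (F : fieldType) (z dz b : F) j : z != 0 ->
  z ^+ j * dz * b = z ^+ j.+1 * b * (dz / z).
Proof. by move=> z0; rewrite exprS; field. Qed.

Lemma closed_prim_root (k : closedFieldType) (n : nat) : (0 < n)%N ->
  n%:R != 0 :> k -> exists z : k, n.-primitive_root z.
Proof.
move=> n0 nk; have [r rE] := closed_field_poly_normal ('X^n - 1 : {poly k}).
have mon : lead_coef ('X^n - 1 : {poly k}) = 1 by apply/eqP; exact: monicXnsubC.
have {}rE : 'X^n - 1 = \prod_(z <- r) ('X - z%:P) by rewrite {1}rE mon scale1r.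
have /hasP[z _ Hz] : has n.-primitive_root r.
  apply: has_prim_root => //.
  - apply/allP => z zr; rewrite unity_rootE; have : root ('X^n - 1) z by rewrite rE root_prod_XsubC.
    by rewrite rootE !hornerE subr_eq0.
  - by rewrite -separable_prod_XsubC -rE separable_Xn_sub_1.
  - have := congr1 (fun q : {poly k} => size q) rE.
    by rewrite size_XnsubC // size_prod_XsubC => -[<-].
by exists z.
Qed.

Section Embeddings.
Variables (k : closedFieldType) (K : fieldType) (iota : {rmorphism k -> K}).
Variables (n m p : nat) (x y : K) (L : diff_val_field k).
Hypotheses (n0 : (0 < n)%N) (m0 : (0 < m)%N).
Hypothesis K_fun : is_function_field iota (fermat_curve k n m) x y.
Hypothesis p_char : p \in [pchar k].

Lemma dv_deriv_pth_power (z : L) : dv_deriv (z ^+ p) = 0.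
Proof.
have pL : p%:R = 0 :> L by rewrite -(rmorph_nat (@dv_const k L)) (pcharf0 p_char) rmorph0.
by rewrite dv_derivXn -mulr_natl pL mul0r.
Qed.

(** Since [p]-th powers have zero derivative, multiplying each term of
    [f = \sum x ^+ s * a s ^+ p] by its exponent [s] computes [x df/dx]; this
    makes the logarithmic derivative of [f] available inside [K], with no
    derivation on [K].  Here it is transported to a field where [dv_deriv]
    exists. *)
Lemma dlog_embedding (phi : K -> L) (a : 'I_p -> K) (xi : L) : xi != 0 ->
  \sum_(s < p) xi ^+ s * phi (a s) ^+ p != 0 ->
  dlog (\sum_(s < p) xi ^+ s * phi (a s) ^+ p) =
  (\sum_(s < p) xi ^+ s * phi (a s) ^+ p *+ s) / (\sum_(s < p) xi ^+ s * phi (a s) ^+ p)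
    * dlog xi.
Proof.
move=> xi0 f0; rewrite {1}/dlog dv_deriv_sum mulrAC; congr (_ / _).
rewrite big_distrl /=; apply: eq_bigr => s _.
rewrite dv_derivM dv_deriv_pth_power mulr0 addr0 dv_derivXn /dlog.
case: (s : nat) => [|j]; first by rewrite !mulr0n !mul0r.
rewrite /= !mulrnAl; congr (_ *+ _).
exact: expr_dlog.
Qed.

Variable a : 'I_p -> K.
Let f := \sum_(s < p) x ^+ s * a s ^+ p.
Let g := \sum_(s < p) x ^+ s * a s ^+ p *+ s.
Hypothesis f_neq0 : f != 0.

Lemma dlog_rmorph (phi : {rmorphism K -> L}) :
  phi x != 0 -> dlog (phi f) = phi (g / f) * dlog (phi x).
Proof.
move=> x0.
have fE : phi f = \sum_(s < p) phi x ^+ s * phi (a s) ^+ p.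
  by rewrite rmorph_sum; apply: eq_bigr => s _; rewrite rmorphM !rmorphXn.
have gE : phi g = \sum_(s < p) phi x ^+ s * phi (a s) ^+ p *+ s.
  by rewrite rmorph_sum; apply: eq_bigr => s _; rewrite rmorphMn rmorphM !rmorphXn.
by rewrite fmorph_div gE fE; apply: dlog_embedding; rewrite // -fE fmorph_eq0.
Qed.

Lemma rmorph_atX (phi : {rmorphism K -> L}) N : (forall c, phi (iota c) = dv_const c) ->
  phi (ev1 iota (x ^+ n) N) = ev1 (@dv_const k L) (phi x ^+ n) N.
Proof.
move=> phiC; elim/poly_ind: N => [|N c IH]; first by rewrite !rmorph0.
by rewrite !(rmorphD, rmorphM) /= !ev1X !ev1C IH phiC rmorphXn.
Qed.

Hypothesis f_ord : forall P : place iota, exists d : int, ord P f = d * p%:Z.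
Hypotheses (n_char : n%:R != 0 :> k) (m_char : m%:R != 0 :> k).

Section Component.
Variables (N : {poly k}) (s : 'I_n -> 'I_m -> {poly k}).
Hypothesis hE : ev1 iota (x ^+ n) N * (g / f) =
  \sum_i \sum_j ev1 iota (x ^+ n) (s i j) * x ^+ i.+1 / y ^+ j.

Variables (X xi ups : L) (c0 : k).
Hypotheses (xiX : xi ^+ n = X) (upsX : ups ^+ m = X + 1).
Hypotheses (X_trans : forall c, X != dv_const c) (c0_ord : dv_ord (X - dv_const c0) != 0).
Local Notation at_X := (ev1 (@dv_const k L) X).

(** Each isotypic component of the regular form [h dlog X], for the group of
    automorphisms [(x, y) |-> (zeta ^+ a * x, eta ^+ b * y)], is itself regular.
    The automorphisms act by changing the embedding, so they need not be
    constructed on [K]. *)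
Lemma component_vge i j :
  vge (dv_ord (at_X N)) (at_X (s i j) * xi ^+ i.+1 / ups ^+ j * dlog X).
Proof.
have X0 : X != 0 by rewrite -(rmorph0 (@dv_const k L)) X_trans.
have xi0 : xi != 0.
  by apply: contraNneq X0 => E; rewrite -xiX E expr0n eqn0Ngt n0.
have ups0 : ups != 0.
  apply/eqP => E; have := X_trans (-1); rewrite rmorphN rmorph1 -addr_eq0 -upsX E.
  by rewrite expr0n eqn0Ngt m0 eqxx.
have [zeta zetaP] : exists z : k, n.-primitive_root z by apply: closed_prim_root.
have [eta etaP] : exists z : k, m.-primitive_root z by apply: closed_prim_root.
(* Regularity of [dlog (phi f)] for the embedding with
   [x |-> zeta ^+ u * xi] and [y |-> eta ^- b * ups]. *)
have twist u b : vge (dv_ord (at_X N)) (\sum_(i < n) dv_const (zeta ^+ (u * (i + 1))) *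
    \sum_(j < m) dv_const (eta ^+ (b * (j + 0))) *
      (at_X (s i j) * xi ^+ i.+1 / ups ^+ j * dlog X)).
  pose xi' := dv_const (zeta ^+ u) * xi; pose ups' := dv_const (eta ^- b) * ups.
  have xi'X : xi' ^+ n = X.
    by rewrite exprMn xiX -rmorphXn -exprM mulnC exprM (prim_expr_order zetaP) expr1n rmorph1 mul1r.
  have ups'X : ups' ^+ m = X + 1.
    rewrite exprMn upsX -rmorphXn -exprVn -exprM mulnC exprM exprVn.
    by rewrite (prim_expr_order etaP) invr1 expr1n rmorph1 mul1r.
  have [||phi [phiC phix phiy]] := ext_rmorphism n0 m0 K_fun (kappa := @dv_const k L) (a := xi') (b := ups').
  - by rewrite xi'X ups'X.
  - by rewrite xi'X.
  have xi'0 : phi x != 0.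
    by rewrite phix; apply: contraNneq X0 => E; rewrite -xi'X E expr0n eqn0Ngt n0.
  have [P [e Pe]] : exists (P : place iota) (e : int), forall z, z != 0 -> dv_ord (phi z) = e * ord P z.
    have E : phi (x ^+ n - iota c0) = X - dv_const c0 by rewrite rmorphB rmorphXn phiC phix xi'X.
    apply: (place_of_embedding phiC (z0 := x ^+ n - iota c0)); last by rewrite E.
    by rewrite -(fmorph_eq0 phi) E subr_eq0 X_trans.
  have reg : vge 0 (dlog (phi f)).
    apply: dlog_regular; first by rewrite fmorph_eq0.
    have [d Hd] := f_ord P; rewrite Pe // Hd mulrA.
    have -> : (e * d * p%:Z)%:~R = (e * d)%:~R * p%:R :> k by rewrite rmorphM.
    by rewrite (pcharf0 p_char) mulr0.
  have E : \sum_(i < n) dv_const (zeta ^+ (u * (i + 1))) *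
      (\sum_(j < m) dv_const (eta ^+ (b * (j + 0))) *
      (at_X (s i j) * xi ^+ i.+1 / ups ^+ j * dlog X)) =
      at_X N * (dv_const n%:R * dlog (phi f)).
    have -> : at_X N = phi (ev1 iota (x ^+ n) N) by rewrite rmorph_atX // phix xi'X.
    have dX : dv_const n%:R * dlog (phi x) = dlog X.
      by rewrite rmorph_nat -xi'X -phix dlogX // mulr_natl.
    rewrite dlog_rmorph // [dv_const _ * _]mulrCA dX mulrA -rmorphM hE.
    rewrite rmorph_sum big_distrl; apply: eq_bigr => i' _.
    rewrite rmorph_sum big_distrl big_distrr; apply: eq_bigr => j' _ /=.
    rewrite fmorph_div rmorphM !rmorphXn rmorph_atX // phix xi'X phiy.
    rewrite addn1 addn0 !exprMn exprM -!rmorphXn invfM -fmorphV.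
    have -> : ((eta ^- b) ^+ j')^-1 = eta ^+ (b * j') by rewrite exprVn invrK exprM.
    by rewrite -exprM; ring.
  rewrite E -[dv_ord _]addr0; apply: vgeM; first by right.
  exact: vgeZ.
apply: (root_filter m_char etaP (r := 0) (V := fun j =>
  at_X (s i j) * xi ^+ i.+1 / ups ^+ j * dlog X)) => b.
exact: (root_filter n_char zetaP (r := 1) (V := fun i => \sum_(j < m)
  dv_const (eta ^+ (b * (j + 0))) * (at_X (s i j) * xi ^+ i.+1 / ups ^+ j * dlog X))
  (fun u => twist u b)).
Qed.

End Component.
End Embeddings.

(** * Poles of the components *)

Section PolynomialOrder.
Variables (k : fieldType) (L : diff_val_field k) (X : L).
Local Notation at_X := (ev1 (@dv_const k L) X).

Lemma vge_poly P : vge 0 X -> vge 0 (at_X P).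
Proof.
move=> X0; apply: ev1_ind => // [c|u v|u v]; first exact: vge_const.
  exact: vgeD.
by rewrite -{3}[0]addr0; exact: vgeM.
Qed.

Lemma at_X_factor c P : exists Q,
  at_X P = at_X Q * (X - dv_const c) + dv_const P.[c].
Proof.
have /factor_theorem[Q QE] : root (P - P.[c]%:P) c by rewrite rootE !hornerE subrr.
have PE : P = Q * ('X - c%:P) + P.[c]%:P by rewrite -QE subrK.
exists Q; rewrite {1}PE rmorphD rmorphM rmorphB /= ev1X !ev1C.
by [].
Qed.

Lemma dv_ord_poly_nonroot c P : vge 0 X -> vge 1 (X - dv_const c) -> P.[c] != 0 ->
  dv_ord (at_X P) = 0.
Proof.
move=> X0 Xc Pc; have [Q ->] := at_X_factor c P.
have cP0 : (dv_const P.[c] : L) != 0 by rewrite fmorph_eq0.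
rewrite addrC; have [|_ ->] := @dv_ord_addl _ _ _ (at_X Q * (X - dv_const c)) cP0.
  rewrite dv_ord_const // -[0 + 1]/(0 + 1 : int).
  by apply: vgeM => //; exact: vge_poly.
exact: dv_ord_const.
Qed.

Lemma vge_poly_root c P M : vge 0 X -> vge M (X - dv_const c) -> P.[c] = 0 ->
  vge M (at_X P).
Proof.
move=> X0 Xc Pc; have [Q ->] := at_X_factor c P.
by rewrite Pc rmorph0 addr0 -[M]add0r; apply: vgeM => //; exact: vge_poly.
Qed.

Lemma dv_ord_poly_pole P : X != 0 -> dv_ord X < 0 -> P != 0 ->
  at_X P != 0 /\ dv_ord (at_X P) = dv_ord X * (size P).-1%:Z.
Proof.
move=> X0 Xneg; elim/poly_ind: P => [|P c IH]; first by rewrite eqxx.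
rewrite rmorphD rmorphM /= ev1X ev1C size_MXaddC.
have [->|P0] := eqVneq P 0.
  rewrite mul0r add0r /= polyC_eq0 => c0; rewrite (negbTE c0) size_poly0 rmorph0.
  by rewrite mul0r add0r fmorph_eq0 c0 mulr0 dv_ord_const.
move=> _ /=; have [P1 P2] := IH P0.
have sP : size P = (size P).-1.+1 by rewrite prednK // size_poly_gt0.
have PX0 : at_X P * X != 0 by rewrite mulf_neq0.
have o : dv_ord (at_X P * X) = dv_ord X * (size P)%:Z.
  by rewrite dv_ordM // P2 {2}sP -addn1 PoszD mulrDr mulr1.
have [|-> ->] := @dv_ord_addl _ _ _ (dv_const c) PX0; last by split.
apply: vgeW (vge_const L c); rewrite o sP.
have : dv_ord X * (size P).-1.+1%:Z < 0 by rewrite nmulr_rlt0.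
lia.
Qed.
End PolynomialOrder.

Lemma dv_ord_quotient (k : fieldType) (L : diff_val_field k) (a b c d : L) :
  a != 0 -> b != 0 -> c != 0 -> d != 0 ->
  a * b / c * d != 0 /\ dv_ord (a * b / c * d) = dv_ord a + dv_ord b - dv_ord c + dv_ord d.
Proof.
move=> a0 b0 c0 d0; have ab0 : a * b != 0 by rewrite mulf_neq0.
have c'0 : c^-1 != 0 by rewrite invr_eq0.
have abc0 : a * b / c != 0 by rewrite mulf_neq0.
by split; [rewrite mulf_neq0|rewrite !dv_ordM // dv_ordV].
Qed.

(** Enough roots to lift the points [c + dv_var ^+ e] of the [x ^ n]-line to the
    curve. *)
Definition has_local_roots (k : fieldType) (L : diff_val_field k) :=
  forall (c : k) r b, (0 < r)%N -> (0 < b)%N -> r%:R != 0 :> k ->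
  exists xi : L, xi ^+ r = dv_const c + dv_var ^+ (r * b).

Section LocalRoots.
Variable k : closedFieldType.
Local Notation L := (laurent_dv k).

(** Hensel's lemma, except for [c = 0] where the root is a power of
    [dv_var]. *)
Lemma laurent_local_roots : has_local_roots L.
Proof.
move=> c r b r0 b0 rk; have [->|c0] := eqVneq c 0.
  by exists (dv_var ^+ b); rewrite rmorph0 add0r -exprM mulnC.
have [|d] := @closed_rootP k ('X^r - c%:P) _; first by rewrite size_XnsubC // eqSS -lt0n.
rewrite rootE !hornerE subr_eq0 => /eqP dc.
have d0 : d != 0 by apply: contraNneq c0 => d0; rewrite -dc d0 expr0n eqn0Ngt r0.
pose F : series k := series_of_poly (c%:P + 'X ^+ (r * b)).
have F0 : F 0%N = d ^+ r.
  by rewrite /F coefs_poly coefD coefC coefXn eqxx dc eq_sym muln_eq0 !eqn0Ngt r0 b0 addr0.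
have [xi _ xiF] := series_root rk d0 F0.
exists (xi%:L : L); rewrite -rmorphXn /= xiF /F rmorphD rmorphXn rmorphD rmorphXn /=.
by [].
Qed.
End LocalRoots.

Section Components.
Variables (k : closedFieldType) (K : fieldType) (iota : {rmorphism k -> K}).
Variables (n m p : nat) (x y : K).
Hypotheses (n0 : (0 < n)%N) (m0 : (0 < m)%N).
Hypothesis K_fun : is_function_field iota (fermat_curve k n m) x y.
Hypothesis p_char : p \in [pchar k].
Variable a : 'I_p -> K.
Let f := \sum_(s < p) x ^+ s * a s ^+ p.
Let g := \sum_(s < p) x ^+ s * a s ^+ p *+ s.
Hypothesis f_neq0 : f != 0.
Hypothesis f_ord : forall P : place iota, exists d : int, ord P f = d * p%:Z.
Hypotheses (n_char : n%:R != 0 :> k) (m_char : m%:R != 0 :> k).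
Variables (N : {poly k}) (s : 'I_n -> 'I_m -> {poly k}).
Hypothesis N0 : N != 0.
Hypothesis hE : ev1 iota (x ^+ n) N * (g / f) =
  \sum_i \sum_j ev1 iota (x ^+ n) (s i j) * x ^+ i.+1 / y ^+ j.
Variable L : diff_val_field k.
Hypothesis local_root : has_local_roots L.
Local Notation e := (n * m)%N.

Lemma nm_char : e%:R != 0 :> k.
Proof. by rewrite natrM mulf_neq0. Qed.

Lemma nm_gt0 : (0 < e)%N. Proof. by rewrite muln_gt0 n0. Qed.

Let vcomp := component_vge (L := L) n0 m0 K_fun p_char f_neq0 f_ord n_char m_char hE.

(** In lowest terms, a root [c] of the denominator would give a pole of the
    component along [x ^ n = c + t ^ (n * m)].  The bounds [i.+1 <= n] and
    [0 <= j] make the estimate uniform, the branch points [c = 0] and [c = -1]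
    included. *)
Lemma component_dvdp i j : N %| s i j.
Proof.
have [->|s0] := eqVneq (s i j) 0; first exact: dvdp0.
set d := gcdp N (s i j).
have d0 : d != 0 by rewrite gcdp_eq0 (negbTE N0).
pose N1 := N %/ d; pose s1 := s i j %/ d.
have NE : N = N1 * d by rewrite divpK // dvdp_gcdl.
have sE : s i j = s1 * d by rewrite divpK // dvdp_gcdr.
have cop : coprimep N1 s1 by apply: coprimep_div_gcd; rewrite N0.
have [|sN1] := eqVneq (size N1) 1%N.
  move/eqP/size_poly1P => [c c0 N1c]; rewrite NE sE N1c mul_polyC dvdpZl //.
  exact: dvdp_mull.
have [c Nc] := closed_rootP N1 sN1; have s1c := coprimep_root cop Nc.
exfalso.
pose w : L := dv_var ^+ e; pose X : L := dv_const c + w.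
have t0 : (dv_var : L) != 0 by exact: dv_var_neq0.
have w0 : w != 0 by rewrite expf_neq0.
have ow : dv_ord w = e%:Z by rewrite dv_ordX // dv_ord_var mul1r.
have Xc : X - dv_const c = w by rewrite /X addrAC subrr add0r.
have e0 := nm_gt0.
have X_trans c' : X != dv_const c'.
  rewrite -subr_eq0; apply/eqP => E.
  have : w = dv_const (c' - c) by rewrite rmorphB -Xc (subr0_eq E).
  have [->|cc] := eqVneq (c' - c) 0; first by rewrite rmorph0 => w00; rewrite w00 eqxx in w0.
  by move=> /(congr1 (@dv_ord k L))/eqP; rewrite ow dv_ord_const // eqz_nat eqn0Ngt e0.
have [xi xiX'] := local_root c n0 m0 n_char.
have xiX : xi ^+ n = X by [].
have [ups upsX'] := local_root (c + 1) m0 n0 m_char.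
have upsX : ups ^+ m = X + 1.
  by rewrite upsX' rmorphD rmorph1 /X /w mulnC addrAC.
have vw M : M <= e%:Z -> vge M (X - dv_const c) by move=> ?; rewrite Xc; right; rewrite ow.
have vX : vge 0 X.
  by apply: vgeD; [exact: vge_const|right; rewrite ow].
have X0 : X != 0 by rewrite -(rmorph0 (@dv_const k L)) X_trans.
have Xp0 : X + 1 != 0.
  by rewrite -[1]opprK subr_eq0 -(rmorph1 (@dv_const k L)) -rmorphN X_trans.
have vXp : vge 0 (X + 1) by apply: vgeD => //; rewrite -(rmorph1 (@dv_const k L)); exact: vge_const.
have at_neq0 P : P != 0 -> ev1 (@dv_const k L) X P != 0.
  by apply: ev1_root_factor.
have c_ord : dv_ord (X - dv_const c) != 0 by rewrite Xc ow eqz_nat -lt0n.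
have N10 : N1 != 0 by apply: contraNneq N0 => E; rewrite NE E mul0r.
have s10 : s1 != 0 by apply: contraNneq s0 => E; rewrite sE E mul0r.
have xi0 : xi != 0.
  by apply: contraNneq X0 => E; rewrite -xiX E expr0n eqn0Ngt n0.
have ups0 : ups != 0.
  by apply: contraNneq Xp0 => E; rewrite -upsX E expr0n eqn0Ngt m0.
have dX : dv_deriv X = dv_const e%:R * dv_var ^+ e.-1.
  rewrite dv_derivD dv_deriv_const add0r dv_derivXn dv_deriv_var mulr1 rmorph_nat.
  by rewrite mulr_natl.
have dX0 : dv_deriv X != 0 by rewrite dX mulf_neq0 ?fmorph_eq0 ?nm_char ?expf_neq0.
have odX : dv_ord (dv_deriv X) = e%:Z - 1.
  rewrite dX dv_ordM ?fmorph_eq0 ?nm_char ?expf_neq0 // dv_ord_const ?nm_char //.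
  by rewrite dv_ordX // dv_ord_var mul1r add0r -subn1 subzn.
have dl0 : dlog X != 0 by rewrite mulf_neq0 // invr_eq0.
have odl : dv_ord (dlog X) = e%:Z - 1 - dv_ord X by rewrite dv_ordM ?invr_eq0 // dv_ordV // odX.
have [z0 zE] := dv_ord_quotient (at_neq0 _ s0) (expf_neq0 i.+1 xi0) (expf_neq0 j ups0) dl0.
have := vge_neq0 z0 (vcomp xiX upsX X_trans c_ord i j).
rewrite zE odl NE sE !rmorphM /= !dv_ordM ?at_neq0 // dv_ordX // dv_ordX //.
have o1 : dv_ord (ev1 (@dv_const k L) X s1) = 0.
  by apply: (dv_ord_poly_nonroot vX _ s1c); apply: vw; rewrite lez_nat.
have oN1 : e%:Z <= dv_ord (ev1 (@dv_const k L) X N1).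
  apply: vge_neq0 (at_neq0 _ N10) _; apply: (vge_poly_root vX) (rootP Nc).
  exact: vw.
have oxi := dv_ordX n xi0; rewrite xiX in oxi.
have oups := dv_ordX m ups0; rewrite upsX in oups.
have := vge_neq0 X0 vX; have := vge_neq0 Xp0 vXp.
rewrite o1 oxi oups => ge1 ge2.
have xi_ge : 0 <= dv_ord xi by rewrite -(pmulr_lge0 _ (_ : 0 < n%:Z)) ?ltz_nat // mulrC.
have ups_ge : 0 <= dv_ord ups by rewrite -(pmulr_lge0 _ (_ : 0 < m%:Z)) ?ltz_nat // mulrC.
have h1 : dv_ord xi * i.+1%:Z <= dv_ord xi * n%:Z by rewrite ler_wpM2l // lez_nat.
have h2 : 0 <= dv_ord ups * j%:Z by rewrite mulr_ge0.
by move: oN1 h1 h2; clear; lia.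
Qed.

(** Along [x ^ n = t ^ - (n * m)], if [s i j / N] has degree [d], the component
    has valuation [j * n - i.+1 * m - 1 - n * m * d], the last [1] coming from the
    differential [dt / t].  As [j < m], this forces [d = 0]. *)
Lemma component_const i j : exists2 c, s i j = c *: N & c != 0 -> (i.+1 * m < j * n)%N.
Proof.
pose q := s i j %/ N; have sE : s i j = q * N by rewrite divpK // component_dvdp.
have [q0|q0] := eqVneq q 0.
  by exists 0; rewrite ?eqxx // sE q0 mul0r scale0r.
have t0 : (dv_var : L) != 0 by exact: dv_var_neq0.
have e0 := nm_gt0.
pose w : L := dv_var ^+ e; have w0 : w != 0 by rewrite expf_neq0.
have ow : dv_ord w = e%:Z by rewrite dv_ordX // dv_ord_var mul1r.
pose X := w^-1; have X0 : X != 0 by rewrite invr_eq0.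
have oX : dv_ord X = - e%:Z by rewrite dv_ordV // ow.
have eneg : - e%:Z < 0 :> int by rewrite oppr_lt0 ltz_nat.
have X_trans c' : X != dv_const c'.
  apply/eqP => E; move: eneg; have [c'0|c'0] := eqVneq c' 0.
    by move: X0; rewrite E c'0 rmorph0 eqxx.
  by rewrite -oX E dv_ord_const.
pose xi : L := (dv_var ^+ m)^-1; have xi0 : xi != 0 by rewrite invr_eq0 expf_neq0.
have xiX : xi ^+ n = X by rewrite exprVn -exprM mulnC.
have [u uE] := local_root 1 m0 n0 m_char.
pose ups : L := u / dv_var ^+ n.
have upsX : ups ^+ m = X + 1.
  rewrite exprMn uE exprVn -exprM rmorph1 mulrDl mul1r [(m * n)%N]mulnC.
  by rewrite mulfV.
have [|Xp0 oXp] := @dv_ord_addl _ _ X 1 X0.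
  right; rewrite dv_ord1 oX; move: e0; clear; lia.
rewrite oX in oXp.
have ups0 : ups != 0.
  by apply: contraNneq Xp0 => E; rewrite -upsX E expr0n eqn0Ngt m0.
have oxi : dv_ord xi = - m%:Z by rewrite dv_ordV ?expf_neq0 // dv_ordX // dv_ord_var mul1r.
have oups : dv_ord ups = - n%:Z.
  have := dv_ordX m ups0; rewrite upsX oXp => H.
  have mz : m%:Z != 0 by rewrite eqz_nat -lt0n.
  by apply: (mulIf mz); rewrite -H mulNr -PoszM.
have dlE : dlog X = dv_const (- e%:R) / dv_var.
  rewrite dlogV // dlogX // /dlog dv_deriv_var rmorphN rmorph_nat mulNr.
  by rewrite mul1r mulr_natl.
have ek : - e%:R != 0 :> k by rewrite oppr_eq0 nm_char.
have dl0 : dlog X != 0 by rewrite dlE mulf_neq0 ?invr_eq0 // fmorph_eq0.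
have odl : dv_ord (dlog X) = -1.
  by rewrite dlE dv_ordM ?fmorph_eq0 ?invr_eq0 // dv_ord_const // dv_ordV // dv_ord_var.
have Xneg : dv_ord X < 0 by rewrite oX.
have [qX0 oq] := dv_ord_poly_pole X0 Xneg q0.
have [NX0 oN] := dv_ord_poly_pole X0 Xneg N0.
have sX0 : ev1 (@dv_const k L) X (s i j) != 0 by rewrite sE rmorphM mulf_neq0.
have [z0 zE] := dv_ord_quotient sX0 (expf_neq0 i.+1 xi0) (expf_neq0 j ups0) dl0.
have c_ord : dv_ord (X - dv_const 0) != 0 by rewrite rmorph0 subr0 oX oppr_eq0 eqz_nat -lt0n.
have := vge_neq0 z0 (vcomp xiX upsX X_trans c_ord i j).
rewrite zE odl sE rmorphM /= dv_ordM // dv_ordX // dv_ordX // oxi oups oq oX => H.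
have {}H : (e * (size q).-1 + i.+1 * m < j * n)%N.
  move: H; rewrite !mulNr opprK -!PoszM [(i.+1 * m)%N]mulnC [(j * n)%N]mulnC; clear.
  by move: (m * i.+1)%N (n * j)%N (_ * (size q).-1)%N (dv_ord _) => A B C D; lia.
have sq : (size q).-1 = 0%N.
  apply/eqP; rewrite -leqn0 leqNgt; apply/negP => sq.
  have : (e * 1 < j * n)%N.
    by apply: leq_ltn_trans H; apply: leq_trans (leq_addr _ _); rewrite leq_mul2l sq orbT.
  by rewrite muln1 mulnC ltn_mul2r [(m < j)%N]ltnNge (ltnW (ltn_ord j)) andbF.
have /size_poly1P[c c0 qc] : size q == 1%N.
  by rewrite -(prednK (_ : 0 < size q)%N) ?size_poly_gt0 // sq.
exists c; first by rewrite qc mul_polyC.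
by move: H; rewrite sq muln0 add0n.
Qed.
End Components.

(** * Logarithmic derivatives and the Frobenius *)

Section FrobeniusPower.
Variables (R : comNzRingType) (p r : nat).
Hypothesis p_char : p \in [pchar R].
Local Notation q := (p ^ r)%N.

Lemma frob_nat : [pchar R].-nat q.
Proof. by rewrite pnatX pnatE ?p_char // (pcharf_prime p_char). Qed.

Lemma exprD_frob (u v : R) : (u + v) ^+ q = u ^+ q + v ^+ q.
Proof. exact: exprDn_pchar frob_nat. Qed.

Lemma frob_gt0 : (0 < q)%N.
Proof. by rewrite expn_gt0 (prime_gt0 (pcharf_prime p_char)). Qed.

Lemma exprN_frob (u : R) : (- u) ^+ q = - u ^+ q.
Proof. exact: exprNn_pchar frob_nat. Qed.
End FrobeniusPower.

Section FrobeniusSeries.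
Variables (k : fieldType) (p r : nat).
Hypothesis p_char : p \in [pchar k].
Local Notation q := (p ^ r)%N.
Local Notation t := (series_of_poly 'X : series k).

Lemma coef_poly_frob (P : {poly k}) i : ~~ (q %| i)%N -> (P ^+ q)`_i = 0.
Proof.
have pP : p \in [pchar {poly k}] by rewrite pchar_poly.
elim/poly_ind: P i => [|P c IH] i qi.
  by rewrite expr0n eqn0Ngt (frob_gt0 _ p_char) coef0.
rewrite (exprD_frob _ pP) exprMn coefD coefMXn -polyC_exp coefC.
case: i qi => [|i] qi; first by rewrite dvdn0 in qi.
rewrite addr0; case: ltnP => // qi'; apply: IH.
by apply: contra qi => d; rewrite -(subnK qi') dvdn_add.
Qed.

Lemma coef_series_frob (F : series k) i : ~~ (q %| i)%N -> (F ^+ q) i = 0.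
Proof.
move=> qi; rewrite (agreeX q (@agree_truncate k i F)) // -rmorphXn.
exact: coef_poly_frob.
Qed.
End FrobeniusSeries.

Section LogarithmicSeries.
Variables (k : closedFieldType) (p r : nat).
Hypothesis p_char : p \in [pchar k].
Local Notation q := (p ^ r)%N.
Local Notation t := (series_of_poly 'X : series k).
Local Notation C c := (series_of_poly c%:P : series k).
Let q0 : (0 < q)%N := frob_gt0 r p_char.

(** For a polynomial with nonzero roots [b_i] the coefficients of [t P' / P] are,
    up to sign, the power sums of the [1 / b_i], and power sums commute with the
    Frobenius; a root [0] contributes the constant [1]. *)
Lemma log_poly_frob (P : {poly k}) : P != 0 -> exists H : series k,
  H * series_of_poly P = t * series_of_poly P^`() /\
  forall N, H (q * N)%N = H N ^+ q.
Proof.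
have [d] := ubnP (size P); elim: d P => // d IH P Pd P0.
have [sP1|sP1] := eqVneq (size P) 1%N.
  have /size_poly1P[c c0 ->] := introT eqP sP1.
  exists 0; split; first by rewrite derivC rmorph0 mulr0 mul0r.
  by move=> N; rewrite !coefs0 expr0n eqn0Ngt q0.
have [b /factor_theorem[Q PE]] := closed_rootP P sP1.
have Q0 : Q != 0 by apply: contraNneq P0 => Q0; rewrite PE Q0 mul0r.
have [|H1 [H1E H1F]] := IH Q _ Q0.
  by move: Pd; rewrite PE size_Mmonic ?monicXsubC // size_XsubC addn2 /=.
suff [H2 [H2E H2F]] : exists H2 : series k, H2 * series_of_poly ('X - b%:P) = t /\
    forall N, H2 (q * N)%N = H2 N ^+ q.
  exists (H1 + H2); split; last first.
    by move=> N; rewrite !coefsD H1F H2F (exprD_frob _ p_char).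
  rewrite PE derivM derivXsubC mulr1 rmorphD !rmorphM /= mulrDl mulrA H1E.
  by rewrite [H2 * _]mulrCA H2E mulrDr mulrA [t * series_of_poly Q]mulrC.
have [->|b0] := eqVneq b 0.
  exists 1; split; first by rewrite subr0 mul1r.
  move=> N; rewrite -(rmorph1 (@series_of_poly k)) /= !coefs_poly !coef1.
  rewrite muln_eq0 eqn0Ngt q0 /=.
  by case: (N == 0%N); rewrite ?expr1n // expr0n eqn0Ngt q0.
(* The expansion of [t / (t - b)]. *)
exists (fun N => if N == 0%N then 0 else - b^-1 ^+ N); split; last first.
  move=> N; rewrite muln_eq0 eqn0Ngt q0 /=.
  case: (N == 0%N); first by rewrite expr0n eqn0Ngt q0.
  by rewrite (exprN_frob _ p_char) -exprM mulnC.
apply: funext => N; rewrite mulrC rmorphB /= mulrBl coefsB coefsXM coefsCM coefs_poly coefX.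
case: N => [|[|N]] /=; first by rewrite mulr0 subrr.
  by rewrite sub0r mulrN opprK expr1 mulfV.
by rewrite [in b * _]exprS mulrN opprK mulrA mulfV // mul1r addNr.
Qed.

(** The Cartier operator fixes logarithmic differentials.  A given coefficient of
    [H] only depends on a truncation of [G], so polynomials suffice. *)
Lemma log_series_frob (G H : series k) : G != 0 -> H * G = t * deriv_series G ->
  forall N, H (q * N)%N = H N ^+ q.
Proof.
move=> G0 HG N.
have [U U0 GE] := ord_seriesP G0; set a := ord_series G in GE.
(* Dividing by [P], of order [a], loses [a] coefficients. *)
pose M := (a + q * N).+1; pose P := truncate M G.
have GP : agree M.+1 G (series_of_poly P) by exact: agree_truncate.
have GP' : agree M G (series_of_poly P) by move=> i iM; apply: GP; rewrite ltnW.
have Pa : P`_a != 0.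
  rewrite -coefs_poly -GP; last by rewrite /M; lia.
  by rewrite GE coefsXnM ltnn subnn.
have P0 : P != 0 by apply: contraNneq Pa => ->; rewrite coef0.
have [H' [H'E H'F]] := log_poly_frob P0.
have HP : agree M ((H - H') * series_of_poly P) 0.
  move=> i iM; rewrite mulrBl coefsB H'E coefs0.
  rewrite -(agreeM (_ : agree M H H) GP') // HG.
  rewrite -deriv_series_poly (agreeM (_ : agree M t t) (agree_deriv GP)) //.
  by rewrite subrr.
suff E i : (i <= q * N)%N -> H i = H' i.
  rewrite !E ?H'F //; apply: leq_pmull; exact: q0.
move=> iN; apply/eqP; rewrite -subr_eq0 -coefsB; apply/eqP.
have [->|D0] := eqVneq (H - H') 0; first by rewrite coefs0.
have Ps0 : series_of_poly P != 0.
  by apply: contraNneq Pa => E; rewrite -coefs_poly E coefs0.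
have := iffRL (ord_series_leP M (mulf_neq0 D0 Ps0)) HP.
have Po : (ord_series (series_of_poly P) <= a)%N.
  rewrite leqNgt; apply/negP => lt; move: Pa.
  by rewrite -coefs_poly (iffLR (ord_series_leP _ Ps0) lt) ?coefs0 ?eqxx.
rewrite ord_seriesM // => le.
have le' : (i.+1 <= ord_series (H - H')%R)%N by move: le Po iN; rewrite /M; clear; lia.
by rewrite (iffLR (ord_series_leP _ D0) le') ?coefs0.
Qed.
End LogarithmicSeries.

Section Vanishing.
Variables (k : closedFieldType) (p r n m u v : nat).
Hypothesis p_char : p \in [pchar k].
Hypotheses (n0 : (0 < n)%N) (m0 : (0 < m)%N) (r0 : (0 < r)%N).
Hypotheses (pn : coprime p n) (pm : coprime p m).
Hypotheses (n_dvd : (n %| p ^ u + 1)%N) (m_dvd : (m %| p ^ v + 1)%N).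
Local Notation q := (p ^ r)%N.
Hypotheses (qn : q = 1 %[mod n]) (qm : q = 1 %[mod m]).
Local Notation t := (series_of_poly 'X : series k).
Variables ups w : series k.
Hypotheses (upsE : ups ^+ m = 1 + t ^+ n) (w_ups : w * ups = 1).

Let p_prime : prime p := pcharf_prime p_char.
Let q0 : (0 < q)%N := frob_gt0 r p_char.

Lemma dvdn_predq d : q = 1 %[mod d] -> (d %| q.-1)%N.
Proof.
by move=> H; rewrite -subn1 -(eqn_mod_dvd _ q0) H.
Qed.

(** With [w] standing for [y^-1]: in [w ^+ j = (1 + t ^+ n) ^+ M * (w ^+ j) ^+ q] the
    last factor is a series in [t ^+ q], and the only exponent of
    [t ^+ i * (1 + t ^+ n) ^+ M] divisible by [q] is [i * q], since the
    exponents are congruent to [i] modulo [n] and less than [n * q].  Its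
    coefficient is the binomial of [dvdn_bin_residue]. *)
Lemma coef_monomial_vanish i j N : (0 < i)%N -> (j < m)%N -> (i * m < j * n)%N ->
  (t ^+ i * w ^+ j) (q * N)%N = 0.
Proof.
move=> i0 jm ij.
have j0 : (0 < j)%N by case: (j) ij.
have i_n : (i < n)%N.
  by rewrite -(ltn_pmul2r m0); apply: ltn_trans ij _; rewrite mulnC ltn_pmul2l.
have [M HM] : exists M, (m * M = j * q.-1)%N.
  by exists (j * (q.-1 %/ m))%N; rewrite mulnCA [(m * _)%N]mulnC divnK // dvdn_predq.
have -> : w ^+ j = (1 + t ^+ n) ^+ M * (w ^+ j) ^+ q.
  rewrite -upsE -exprM HM -[in RHS]exprM -[in X in _ * X](prednK q0) mulnS exprD.
  by rewrite mulrC -mulrA -exprMn w_ups expr1n mulr1.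
rewrite mulrA coefsM big1 // => a _.
have [qa|qa] := boolP (q %| a)%N; last first.
  rewrite (coef_series_frob p_char) ?mulr0 //.
  by rewrite dvdn_subr ?dvdn_mulr // -ltnS.
suff -> : (t ^+ i * (1 + t ^+ n) ^+ M) a = 0 by rewrite mul0r.
rewrite coefsXnM; case: ltnP => // ia.
have -> : (1 + t ^+ n) ^+ M = series_of_poly ((1 + 'X^n) ^+ M).
  by rewrite rmorphXn rmorphD rmorph1 rmorphXn.
rewrite coefs_poly exprDn coef_sum big1 // => -[l /= lM] _.
rewrite expr1n mul1r coefMn -exprM coefXn.
case: eqP => [al|_]; last by rewrite mul0rn.
have aE : (a : nat) = (i + n * l)%N by rewrite -al subnKC.
case/dvdnP: qa => b ab.
have bn : (b < n)%N.
  rewrite -(ltn_pmul2r q0) -ab aE -(ltn_pmul2l m0).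
  apply: leq_ltn_trans (_ : m * (i + n * M) < _)%N.
    by rewrite leq_pmul2l // leq_add2l leq_pmul2l // -ltnS.
  have -> : (m * (i + n * M) = i * m + n * (m * M))%N by ring.
  rewrite HM; apply: leq_trans (_ : j * n * q <= _)%N; last first.
    by rewrite mulnA leq_pmul2r // leq_pmul2r // ltnW.
  by rewrite -{2}(prednK q0) mulnS [(n * _)%N]mulnCA mulnA ltn_add2r.
have bi : b = i.
  have : (b = i %[mod n])%N.
    have : (b * q = i + n * l %[mod n])%N by rewrite -ab aE.
    by rewrite -modnMmr qn modnMmr muln1 addnC [(n * l)%N]mulnC modnMDl.
  by rewrite !modn_small.
have lE : (n * l = i * q.-1)%N.
  by apply/eqP; rewrite -(eqn_add2l i) -aE ab bi -mulnS prednK.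
have : (p %| 'C(M, l))%N.
  apply: (dvdn_bin_residue p_prime n_dvd m_dvd pn pm qn qm _ _ ij lE HM r0).
    by rewrite i0.
  by rewrite j0.
by case/dvdnP => c ->; rewrite mulnC mulrnA /= (pcharf0 p_char) mul0rn.
Qed.
End Vanishing.

(** * Vanishing of the holomorphic logarithmic differentials *)

Section LogDerivative.
Variables (k : closedFieldType) (p r : nat).
Hypothesis p_char : p \in [pchar k].
Local Notation L := (laurent_dv k).

(** A Laurent series [A / B] has the same logarithmic derivative as the power
    series [A * B ^+ p.-1], from which it differs by a [p]-th power. *)
Lemma dlog_laurent_frob (z : L) (H : series k) : z != 0 ->
  dlog z = (H%:L : L) / dv_var -> forall N, H (p ^ r * N)%N = H N ^+ (p ^ r).
Proof.
have [A [B [B0 zE]]] := laurent_fracP z => z0 dz.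
have A0 : A != 0 by apply: contraNneq z0 => A0; rewrite zE A0 rmorph0 mul0r.
have p0 := prime_gt0 (pcharf_prime p_char).
pose G := A * B ^+ p.-1.
have G0 : G != 0 by rewrite mulf_neq0 ?expf_neq0.
apply: (@log_series_frob k p r p_char G H G0).
have Bz : (B%:L : L) != 0 by rewrite tofrac_eq0.
have GE : (G%:L : L) = z * (B%:L : L) ^+ p.
  rewrite zE -[in RHS](prednK p0) exprS mulrA divfK // -rmorphXn -rmorphM.
  by [].
have dG : dlog (G%:L : L) = (H%:L : L) / dv_var.
  rewrite GE dlogM ?expf_neq0 // dlogX // -mulr_natl.
  have -> : p%:R = 0 :> L by rewrite -(rmorph_nat (@dv_const k L)) (pcharf0 p_char) rmorph0.
  by rewrite mul0r addr0.
have Gz : (G%:L : L) != 0 by rewrite tofrac_eq0.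
have t0 := dv_var_neq0 L.
have E : (H%:L : L) * (G%:L : L) = dv_var * dv_deriv (G%:L : L).
  have -> : dv_deriv (G%:L : L) = dlog (G%:L : L) * (G%:L : L) by rewrite divfK.
  by rewrite dG mulrA mulrCA mulfV ?mulr1.
move: E; rewrite [dv_deriv _]laurent_deriv_series -!rmorphM => /eqP.
by rewrite tofrac_eq => /eqP.
Qed.
End LogDerivative.

(** The nonzero terms have valuations [s] modulo [p], hence are pairwise distinct:
    the powers of the uniformizer are independent over the p-th powers. *)
Lemma pth_power_independent (k : fieldType) (L : diff_val_field k) (p : nat)
    (b : 'I_p -> L) : p \in [pchar k] ->
  \sum_(s < p) dv_var ^+ s * b s ^+ p *+ s = 0 ->
  forall s : 'I_p, (s != 0 :> nat)%N -> b s = 0.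
Proof.
move=> p_char b_sum s sn0; have p0 := prime_gt0 (pcharf_prime p_char).
have t0 := dv_var_neq0 L.
pose F (s : 'I_p) : L := dv_var ^+ s * b s ^+ p *+ s.
have FE s' : F s' = dv_const s'%:R * (dv_var ^+ s' * b s' ^+ p).
  by rewrite /F -mulr_natl rmorph_nat.
have F_neq0 s' : F s' != 0 -> b s' != 0 /\ s'%:R != 0 :> k.
  rewrite FE => H; split; apply: contraNneq H => ->.
    by rewrite expr0n eqn0Ngt p0 !mulr0.
  by rewrite rmorph0 mul0r.
have F_ord s' : F s' != 0 -> dv_ord (F s') = s'%:Z + dv_ord (b s') * p%:Z.
  move=> /F_neq0[b0 s0]; rewrite FE.
  have c0 : (dv_const s'%:R : L) != 0 by rewrite fmorph_eq0.
  rewrite dv_ordM ?mulf_neq0 ?expf_neq0 // dv_ord_const // add0r.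
  by rewrite dv_ordM ?expf_neq0 // !dv_ordX // dv_ord_var mul1r.
have /(_ s)/eqP : forall s', F s' = 0.
  apply: distinct_dv_ord b_sum => s1 s2 sF s'F; rewrite !F_ord //.
  move: (dv_ord _) (dv_ord _) => d' d E; apply: val_inj => /=.
  have : (s1%:Z = s2 %[mod p])%Z.
    apply/eqP; rewrite eqz_mod_dvd; apply/dvdzP; exists (d' - d).
    have -> : s1%:Z = s2%:Z + d' * p%:Z - d * p%:Z by rewrite -E addrK.
    by ring.
  by rewrite !modz_small /= ?ltz_nat ?ltn_ord // => -[].
have sk : s%:R != 0 :> k by rewrite -(dvdn_pcharf p_char) gtnNdvd // lt0n.
rewrite FE !mulf_eq0 fmorph_eq0 (negbTE sk) !expf_eq0 (negbTE t0) andbF /=.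
by move/andP=> [_ /eqP].
Qed.

Section FermatVanishing.
Variables (k : closedFieldType) (K : fieldType) (iota : {rmorphism k -> K}).
Variables (n m p u v : nat) (x y : K).
Hypotheses (n0 : (0 < n)%N) (m0 : (0 < m)%N).
Hypothesis K_fun : is_function_field iota (fermat_curve k n m) x y.
Hypothesis p_char : p \in [pchar k].
Hypotheses (pn : coprime p n) (pm : coprime p m).
Hypotheses (n_dvd : (n %| p ^ u + 1)%N) (m_dvd : (m %| p ^ v + 1)%N).
Local Notation L := (laurent_dv k).

Let p_prime : prime p := pcharf_prime p_char.

Lemma natr_coprime d : coprime p d -> d%:R != 0 :> k.
Proof. by rewrite -(dvdn_pcharf p_char) -prime_coprime. Qed.

(** The branch of the curve at [x = 0], [y = 1], where [x] is the uniformizer. *)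
Lemma branch_at_zero : exists (phi : {rmorphism K -> L}) (w : series k) (ups : series k),
  [/\ forall c, phi (iota c) = dv_const c, phi x = dv_var, (phi y)^-1 = (w%:L : L),
      ups ^+ m = 1 + series_of_poly 'X ^+ n & w * ups = 1].
Proof.
pose F : series k := 1 + series_of_poly 'X ^+ n.
have F0 : F 0%N = 1 ^+ m.
  by rewrite /F coefsD coefs1_0 coefsXn eq_sym eqn0Ngt n0 addr0 expr1n.
have [ups ups0 upsE] := series_root (natr_coprime pm) (oner_neq0 k) F0.
have [|w wE] := @series_inverse k ups; first by rewrite ups0 oner_neq0.
have [||phi [phiC phix phiy]] :=
    ext_rmorphism n0 m0 K_fun (kappa := @dv_const k L) (a := dv_var) (b := (ups%:L : L)).
- rewrite -rmorphXn /= upsE rmorphD rmorph1 rmorphXn addrC.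
  by [].
- move=> c; apply/eqP => E.
  have : dv_ord (dv_var ^+ n : L) = n%:Z by rewrite dv_ordX ?dv_var_neq0 // dv_ord_var mul1r.
  rewrite E; have [c0|c0] := eqVneq c 0.
    by have := expf_neq0 n (dv_var_neq0 L); rewrite E c0 rmorph0 eqxx.
  by rewrite dv_ord_const // => /eqP; rewrite eq_sym eqz_nat eqn0Ngt n0.
exists phi, w, ups; split=> //.
have u0 : (ups%:L : L) != 0 by rewrite -phiy; apply/eqP => E; move: wE (congr1 (fun z : L => (w%:L : L) * z) E); rewrite phiy -rmorphM => ->; rewrite rmorph1 mulr0 => /eqP; rewrite oner_eq0.
rewrite phiy; apply: (mulIf u0); rewrite mulVf // -rmorphM wE.
by rewrite rmorph1.
Qed.

Variables (a : 'I_p -> K) (lambda : 'I_n -> 'I_m -> k).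
Let f := \sum_(s < p) x ^+ s * a s ^+ p.
Let g := \sum_(s < p) x ^+ s * a s ^+ p *+ s.
Hypothesis f_neq0 : f != 0.
Hypothesis holomorphic : g / f =
  \sum_i \sum_j iota (lambda i j) * x ^+ i.+1 / y ^+ j.
Hypothesis lambdaP : forall i j, lambda i j != 0 -> (i.+1 * m < j * n)%N.

Lemma holomorphic_log_eq0 : g = 0.
Proof.
have [phi [w [ups [phiC phix phiy upsE wE]]]] := branch_at_zero.
pose H : series k := \sum_i \sum_j
  series_of_poly (lambda i j)%:P * (series_of_poly 'X ^+ i.+1 * w ^+ j).
have HE : phi (g / f) = (H%:L : L).
  rewrite holomorphic !rmorph_sum; apply: eq_bigr => i _.
  rewrite !rmorph_sum; apply: eq_bigr => j _.
  rewrite fmorph_div rmorphM !rmorphXn phiC phix -exprVn phiy !rmorphM !rmorphXn.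
  by rewrite mulrA.
(* By Euler's theorem, [p ^ r] is [1] modulo [n] and modulo [m]. *)
pose r := (totient n * totient m)%N.
have r0 : (0 < r)%N by rewrite muln_gt0 !totient_gt0 n0.
have qn : (p ^ r = 1 %[mod n])%N.
  by rewrite /r expnM -modnXm Euler_exp_totient // modnXm exp1n.
have qm : (p ^ r = 1 %[mod m])%N.
  by rewrite /r mulnC expnM -modnXm Euler_exp_totient // modnXm exp1n.
have H0 : H = 0.
  apply: funext => N.
  have dH : dlog (phi f) = (H%:L : L) / dv_var.
    rewrite dlog_rmorph // ?phix ?dv_var_neq0 // HE /dlog dv_deriv_var.
    by rewrite mul1r.
  have := dlog_laurent_frob r p_char (_ : phi f != 0) dH N.
  rewrite fmorph_eq0 => /(_ f_neq0).
  have -> : H (p ^ r * N)%N = 0.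
    rewrite /H coefs_sum big1 // => i _; rewrite coefs_sum big1 // => j _.
    rewrite coefsCM; have [->|/lambdaP ij] := eqVneq (lambda i j) 0; first by rewrite mul0r.
    by rewrite (coef_monomial_vanish p_char n0 m0 r0 pn pm n_dvd m_dvd qn qm upsE wE) ?mulr0.
  by move/esym/eqP; rewrite expf_eq0 => /andP[_ /eqP->]; rewrite coefs0.
have /eqP : phi (g / f) = 0 by rewrite HE H0 rmorph0.
by rewrite fmorph_eq0 mulf_eq0 invr_eq0 (negbTE f_neq0) orbF => /eqP.
Qed.

Lemma pth_power_of_log_eq0 : g = 0 -> exists b, f = b ^+ p.
Proof.
move=> g0; have [phi [_ [_ [_ phix _ _ _]]]] := branch_at_zero.
have p0 := prime_gt0 p_prime.
have a0 (s : 'I_p) : (s != 0 :> nat)%N -> a s = 0.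
  move=> s0; apply/eqP; rewrite -(fmorph_eq0 phi); apply/eqP.
  apply: (pth_power_independent (L := L) p_char (b := fun s => phi (a s))) s0.
  transitivity (phi g); last by rewrite g0 rmorph0.
  by rewrite rmorph_sum; apply: eq_bigr => s' _; rewrite rmorphMn rmorphM !rmorphXn phix.
exists (a (Ordinal p0)); rewrite /f (bigD1 (Ordinal p0)) //= mul1r big1 ?addr0 // => s s0.
by rewrite a0 // expr0n eqn0Ngt p0 mulr0.
Qed.
End FermatVanishing.

Section Main.
Variables (k : closedFieldType) (K : fieldType) (iota : {rmorphism k -> K}).
Variables (n m p u v : nat) (x y : K).
Hypotheses (n0 : (0 < n)%N) (m0 : (0 < m)%N).
Hypothesis K_fun : is_function_field iota (fermat_curve k n m) x y.
Hypothesis p_char : p \in [pchar k].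
Hypotheses (pn : coprime p n) (pm : coprime p m).
Hypotheses (n_dvd : (n %| p ^ u + 1)%N) (m_dvd : (m %| p ^ v + 1)%N).

Lemma pth_power_of_ord f : f != 0 ->
  (forall P : place iota, exists d : int, ord P f = d * p%:Z) ->
  exists b, f = b ^+ p.
Proof.
have nk := natr_coprime p_char pn; have mk := natr_coprime p_char pm.
have pK : p \in [pchar K] by apply: rmorph_pchar p_char.
have [a ->] : pth_span x p f.
  by apply: (pth_span_all m0 K_fun pK); rewrite coprime_sym.
set F := \sum_(s < p) _ => F0 F_ord.
pose g := \sum_(s < p) x ^+ s * a s ^+ p *+ s.
have [phi [w [ups [phiC phix phiy upsE wE]]]] := branch_at_zero n0 m0 K_fun p_char pm.
have x0 : x != 0 by rewrite -(fmorph_eq0 phi) phix dv_var_neq0.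
have y0 : y != 0.
  rewrite -(fmorph_eq0 phi) -invr_eq0 phiy tofrac_eq0; apply/eqP => w0.
  by move/eqP: wE; rewrite w0 mul0r eq_sym oner_eq0.
(* The factor [y ^+ m.-1 / x] converts the basis [x ^+ i * y ^+ j] of
   [fermat_span] into the monomials [x ^+ i.+1 / y ^+ j]. *)
have [N N0 [s sE]] := fermat_span_denominator n0 m0 K_fun (g / F / x * y ^+ m.-1).
have hE : ev1 iota (x ^+ n) N * (g / F) =
    \sum_i \sum_j ev1 iota (x ^+ n) (s i (rev_ord j)) * x ^+ i.+1 / y ^+ j.
  have xy0 : x^-1 * y ^+ m.-1 != 0 by rewrite mulf_neq0 ?invr_eq0 ?expf_neq0.
  apply: (mulIf xy0); rewrite -mulrA [_ / F * _]mulrA sE big_distrl.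
  apply: eq_bigr => i _; rewrite [RHS]big_distrl (reindex_inj rev_ord_inj).
  apply: eq_bigr => j _ /=.
  have -> : y ^+ m.-1 = y ^+ j * y ^+ (m - j.+1).
    by rewrite -exprD; congr (_ ^+ _); move: (ltn_ord j); clear; lia.
  by rewrite exprS; field; rewrite x0 expf_neq0.
have cst i j : {c | s i (rev_ord j) = c *: N & c != 0 -> (i.+1 * m < j * n)%N}.
  apply: cid2.
  exact: (component_const n0 m0 K_fun p_char F0 F_ord nk mk N0 hE (laurent_local_roots (k := k)) i j).
pose lambda i j := s2val (cst i j).
have X0 : ev1 iota (x ^+ n) N != 0.
  rewrite -(fmorph_eq0 phi) rmorph_atX // phix; apply: ev1_root_factor => // c.
  apply/eqP => E; have := expf_neq0 n (dv_var_neq0 (laurent_dv k)).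
  have : dv_ord (dv_var ^+ n : laurent_dv k) = n%:Z by rewrite dv_ordX ?dv_var_neq0 // dv_ord_var mul1r.
  rewrite E fmorph_eq0 => + c0; rewrite dv_ord_const // => /eqP.
  by rewrite eq_sym eqz_nat eqn0Ngt n0.
apply: (pth_power_of_log_eq0 n0 m0 K_fun p_char pm).
apply: (holomorphic_log_eq0 n0 m0 K_fun p_char pn pm n_dvd m_dvd F0 (lambda := lambda)).
  apply: (mulfI X0); rewrite hE big_distrr; apply: eq_bigr => i _ /=.
  rewrite big_distrr; apply: eq_bigr => j _ /=.
  rewrite (s2valP (cst i j)) -mul_polyC rmorphM /= ev1C -/(lambda i j).
  by rewrite -!mulrA [RHS]mulrCA.
by move=> i j; exact: (s2valP' (cst i j)).
Qed.
End Main.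

(** * Torsion of the Jacobian *)

Section TorsionFree.
Local Open Scope quotient_scope.

(** If [p D = div f] and [f = b ^+ p], then [D = div b]. *)
Lemma p_rank0 (k : closedFieldType) (K : fieldType) (iota : {rmorphism k -> K})
    (p : nat) : (0 < p)%N ->
  (forall f : K, f != 0 ->
    (forall P : place iota, exists d : int, ord P f = d * p%:Z) ->
    exists b, f = b ^+ p) ->
  has_p_rank iota p 0.
Proof.
move=> p0 pth; exists (@GRing.null_fun 'rV['F_p]_0 (jacobian iota)).
split=> [w w' _|c]; first by rewrite (thinmx0 w) (thinmx0 w').
split=> [cp|[w ->]]; last by rewrite /= mul0rn.
exists 0; rewrite /=.
move: cp; rewrite -[c]reprK; set D := repr c => cp.
have pi0 : \pi_(jacobian iota) 0 = 0 by rewrite piE.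
have cpE : \pi_(jacobian iota) (D *+ p) = \pi_(jacobian iota) D *+ p.
  elim: (p) => [|e IH]; first by rewrite !mulr0n piE.
  by rewrite !mulrS -IH piE.
have : D *+ p \in @principal k K iota.
  by rewrite -[D *+ p]subr0 Quotient.idealrBE cpE cp pi0 eqxx.
move=> /asboolP[f f0 fD].
have valX : divisor0_val (D *+ p) = divisor0_val D *+ p.
  by elim: (p) => // e IH; rewrite !mulrS -IH.
have [|b bE] := pth f f0.
  move=> P; exists (coeff (P : {classic place iota}) (divisor0_val D)).
  by rewrite -fD valX coeffMn -mulr_natr natz.
have b0 : b != 0 by apply: contraNneq f0 => b0; rewrite bE b0 expr0n eqn0Ngt p0.
have ordX (P : place iota) e : ord P (b ^+ e) = ord P b * e%:Z.
  elim: e => [|e IH]; first by rewrite expr0 mulr0 -(rmorph1 iota) ord_const // oner_neq0.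
  by rewrite exprS ordM ?expf_neq0 // IH -addn1 PoszD mulrDr mulr1 addrC.
suff : D \in @principal k K iota.
  by move=> Dp; rewrite -pi0; apply/eqP; rewrite -Quotient.idealrBE subr0.
apply/asboolP; exists b => // P.
have pz : p%:Z != 0 by rewrite eqz_nat -lt0n.
apply: (mulIf pz); rewrite -ordX -bE -fD.
by rewrite valX coeffMn -mulr_natr natz.
Qed.

End TorsionFree.

Theorem theorem4p8
  (p : nat) (p_prime : prime p)
  (k : closedFieldType) (Fp_to_k : {rmorphism 'F_p -> k})
  (k_alg : integralRange Fp_to_k)
  (n m u v : nat) (n_gt0 : (0 < n)%N) (m_gt0 : (0 < m)%N)
  (n_coprime : coprime n p) (m_coprime : coprime m p)
  (n_dvd : (n %| p ^ u + 1)%N) (m_dvd : (m %| p ^ v + 1)%N)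
  (K : fieldType) (iota : {rmorphism k -> K}) (x y : K)
  (K_fun : is_function_field iota (fermat_curve k n m) x y) :
  has_p_rank iota p 0.
Proof.
have p_char : p \in [pchar k] by apply: (rmorph_pchar Fp_to_k); exact: pchar_Fp.
apply: p_rank0 (prime_gt0 p_prime) _ => f f0 f_ord.
by apply: (pth_power_of_ord n_gt0 m_gt0 K_fun p_char _ _ n_dvd m_dvd f0 f_ord);
  rewrite coprime_sym.
Qed.
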